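(* Let $Q$ be a quiver and let $C\subseteq \Bbbk Q$ be an admissible subcoalgebra of the path coalgebra $\Bbbk Q$. Then its tail closure $T(C)$ is a generator of the category of its left comodules.
   Context: $\Bbbk$ is a field. A quiver $Q$ has vertex set $Q_0$ and arrow set $Q_1$, each arrow $\alpha$ having a source $s(\alpha)$ and target $t(\alpha)$. Paths are the trivial paths (identified with the vertices) and finite sequences $\alpha_1\cdots\alpha_n$ of arrows with $t(\alpha_i)=s(\alpha_{i+1})$; concatenation $xy$ is defined when $t(x)=s(y)$, and is extended bilinearly. The path coalgebra $\Bbbk Q$ has basis all paths, with $\Delta(p)=\sum_{xy=p}x\otimes y$ and $\varepsilon(p)=1$ if $p$ is trivial, $0$ otherwise. A subcoalgebra $C\subseteq\Bbbk Q$ is admissible if it contains all vertices and arrows of $Q$. A right coideal of a coalgebra $D$ is a subspace $I$ with $\Delta(I)\subseteq I\otimes D$; for $x\in D$, $\langle x\rangle^D$ denotes the smallest right coideal of $D$ containing $x$. A multipath is a nonzero linear combination of paths all having the same source and the same target; $M(C)$ is the set of multipaths lying in $C$. A subset $F\subseteq M(C)$ is independent if it is linearly independent and $\langle x\rangle^C\cap F=\{x\}$ for all $x\in F$. Tail closure: for a subcoalgebra $C\subseteq \Bbbk Q$, let $\overline{Q}$ be the quiver obtained from $Q$ by adding, for each finite independent set $F=\{p_1,\dots,p_n\}\subseteq M(C)$ (with a fixed enumeration), a new vertex $e_F$ and $n$ new arrows $\alpha_{i,F}:t(p_i)\to e_F$; put $q_F=p_1\alpha_{1,F}+\cdots+p_n\alpha_{n,F}\in\Bbbk\overline{Q}$,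 and let $\overline{C}$ be the subcoalgebra of $\Bbbk\overline{Q}$ generated by $C$ and all such $q_F$. Set $T^0(Q)=Q$, $T^0(C)=C$, $T^{n+1}(Q)=\overline{T^n(Q)}$, $T^{n+1}(C)=\overline{T^n(C)}$; then $T(C)=\bigcup_n T^n(C)\subseteq\Bbbk T(Q)$ with $T(Q)=\bigcup_nT^n(Q)$. An object $G$ of a category with coproducts is a generator if for every object $X$ there is a set $I$ and an epimorphism $G^{(I)}\to X$. *)

(* Defs.v *)
From HB Require Import structures.
From mathcomp Require Import all_boot all_algebra finmap.
From mathcomp.multinomials Require Import monalg.
From Stdlib Require Import ClassicalEpsilon.
Set Implicit Arguments. Unset Strict Implicit. Unset Printing Implicit Defensive.
Import GRing.Theory.
Local Open Scope ring_scope.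

Definition pb (P : Prop) : bool :=
  if excluded_middle_informative P then true else false.

Lemma pbP (P : Prop) : reflect P (pb P).
Proof. by rewrite /pb; case: excluded_middle_informative => h; constructor. Qed.

Record quiver := Quiver {
  qV : choiceType; qA : choiceType; qs : qA -> qV; qt : qA -> qV }.

Section PathCoalgebra.
Variables (k : fieldType) (Q : quiver).

(* raw path = (starting vertex, list of arrows); it is a path of Q when
   [valid] holds.  (v, [::]) is the trivial path at v. *)
Definition rpath := (qV Q * seq (qA Q))%type.

Fixpoint valid_from (v : qV Q) (s : seq (qA Q)) : bool :=
  match s with
  | [::] => true
  | a :: s' => (qs a == v) && valid_from (qt a) s'
  end.
Definition valid (p : rpath) : bool := valid_from p.1 p.2.
Definition psource (p : rpath) : qV Q := p.1.
Definition ptarget (p : rpath) : qV Q := last p.1 (map (@qt Q) p.2).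
Definition trivp (v : qV Q) : rpath := (v, [::]).
Definition arrowp (a : qA Q) : rpath := (qs a, [:: a]).

Definition kQ := {malg k[rpath]}.
Definition kQ2 := {malg k[(rpath * rpath)%type]}.   (* kQ (x) kQ *)
Definition in_kQ (x : kQ) : Prop := forall p, p \in msupp x -> valid p.

Definition splits (p : rpath) : seq (rpath * rpath) :=
  [seq ((p.1, take i p.2), (ptarget (p.1, take i p.2), drop i p.2))
  | i <- iota 0 (size p.2).+1].

Definition comult (x : kQ) : kQ2 :=
  \sum_(p <- msupp x) \sum_(s <- splits p) << x@_p *g s >>.

Definition tens (x y : kQ) : kQ2 :=
  \sum_(p <- msupp x) \sum_(q <- msupp y) << x@_p * y@_q *g (p, q) >>.

Definition subspace (C : kQ -> Prop) : Prop :=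
  C 0 /\ forall a x y, C x -> C y -> C (a *: x + y).

Definition in_tensor (C D : kQ -> Prop) (z : kQ2) : Prop :=
  exists s : seq (kQ * kQ), (forall t, List.In t s -> C t.1 /\ D t.2) /\
    z = \sum_(t <- s) tens t.1 t.2.

Definition subcoalgebra (C : kQ -> Prop) : Prop :=
  (forall x, C x -> in_kQ x) /\ subspace C /\
  forall x, C x -> in_tensor C C (comult x).

Definition admissible (C : kQ -> Prop) : Prop :=
  subcoalgebra C /\ (forall v, C << (1 : k) *g trivp v >>) /\
  (forall a, C << (1 : k) *g arrowp a >>).

Definition right_coideal (D I : kQ -> Prop) : Prop :=
  (forall x, I x -> D x) /\ subspace I /\
  forall x, I x -> in_tensor I D (comult x).

Definition in_gen_rcoideal (D : kQ -> Prop) (x y : kQ) : Prop :=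
  forall I, right_coideal D I -> I x -> I y.

Definition multipath (x : kQ) : Prop :=
  x != 0 /\ exists v w, forall p, p \in msupp x ->
    valid p /\ psource p = v /\ ptarget p = w.

Definition lin_indep (F : {fset kQ}) : Prop :=
  forall c : kQ -> k, \sum_(x <- F) c x *: x = 0 -> forall x, x \in F -> c x = 0.

Definition independent (C : kQ -> Prop) (F : {fset kQ}) : Prop :=
  (forall x, x \in F -> C x /\ multipath x) /\ lin_indep F /\
  (forall x y, x \in F -> y \in F -> in_gen_rcoideal C x y -> y = x).

End PathCoalgebra.

Section TailClosure.
Variable k : fieldType.

Record stage := Stage { sQ : quiver; sC : kQ k (sQ) -> Prop }.

Section Bar.
Variable S : stage.
Let Q := sQ S.

Definition newV := {F : {fset kQ k Q} | pb (independent (@sC S) F)}.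
Definition newA := {F : newV & 'I_#|` val F|}.

Definition Fp (F : newV) (i : 'I_#|` val F|) : kQ k Q :=
  nth 0 (enum_fset (val F)) i.

Definition barV := (qV Q + newV)%type.
Definition barA := (qA Q + newA)%type.

(* source of alpha_{i,F} is t(p_i) (the common target of the paths of the
   multipath p_i; the default e_F is never used since p_i <> 0). *)
Definition bars (a : barA) : barV :=
  match a with
  | inl a => inl (qs a)
  | inr (existT F i) =>
      match enum_fset (msupp (Fp i)) with
      | p :: _ => inl (ptarget p)
      | [::] => inr F
      end
  end.
Definition bart (a : barA) : barV :=
  match a with
  | inl a => inl (qt a)
  | inr (existT F _) => inr F
  end.

Definition barQ : quiver := @Quiver barV barA bars bart.

Definition embp (p : rpath Q) : rpath barQ := (inl p.1, map inl p.2).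
Definition embk (x : kQ k Q) : kQ k barQ :=
  \sum_(p <- msupp x) << x@_p *g embp p >>.

Definition qF (F : newV) : kQ k barQ :=
  \sum_(i < #|` val F|) \sum_(p <- msupp (Fp i))
     << (Fp i)@_p *g ((inl p.1, rcons (map inl p.2) (inr (existT _ F i)))
                     : rpath barQ) >>.

Definition barC (z : kQ k barQ) : Prop :=
  forall D, subcoalgebra D -> (forall x, @sC S x -> D (embk x)) ->
    (forall F, D (qF F)) -> D z.

Definition bar : stage := @Stage barQ barC.
End Bar.

Fixpoint iter_bar (S0 : stage) (n : nat) : stage :=
  match n with 0 => S0 | n.+1 => bar (iter_bar S0 n) end.

Section Union.
Variable S0 : stage.

Definition TV := (qV (sQ S0) + {n : nat & newV (iter_bar S0 n)})%type.
Definition TA := (qA (sQ S0) + {n : nat & newA (iter_bar S0 n)})%type.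

Local Unset Implicit Arguments.
Fixpoint embV (n : nat) : qV (sQ (iter_bar S0 n)) -> TV :=
  match n return qV (sQ (iter_bar S0 n)) -> TV with
  | 0 => fun v => inl v
  | n.+1 => fun v => match v with
                     | inl v => embV n v
                     | inr F => inr (existT _ n F)
                     end
  end.
Fixpoint embA (n : nat) : qA (sQ (iter_bar S0 n)) -> TA :=
  match n return qA (sQ (iter_bar S0 n)) -> TA with
  | 0 => fun a => inl a
  | n.+1 => fun a => match a with
                     | inl a => embA n a
                     | inr b => inr (existT _ n b)
                     end
  end.

Local Set Implicit Arguments.
Definition Ts (a : TA) : TV :=
  match a with
  | inl a => inl (qs a)
  | inr (existT n b) => embV n.+1 (bars (inr b))
  end.
Definition Tt (a : TA) : TV :=
  match a with
  | inl a => inl (qt a)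
  | inr (existT n b) => embV n.+1 (bart (inr b))
  end.

(* T(Q) = union of the T^n(Q) *)
Definition TQ : quiver := @Quiver TV TA Ts Tt.

Definition embP n (p : rpath (sQ (iter_bar S0 n))) : rpath TQ :=
  (embV n p.1, map (embA n) p.2).
Definition embK n (x : kQ k (sQ (iter_bar S0 n))) : kQ k TQ :=
  \sum_(p <- msupp x) << x@_p *g embP p >>.

Definition TC (x : kQ k TQ) : Prop :=
  exists n (c : kQ k (sQ (iter_bar S0 n))), @sC _ c /\ x = embK c.
End Union.
End TailClosure.

Definition tail_quiver (k : fieldType) (Q : quiver) (C : kQ k Q -> Prop) :=
  @TQ k (@Stage k Q C).
Definition tail_coalg (k : fieldType) (Q : quiver) (C : kQ k Q -> Prop) :
  kQ k (tail_quiver C) -> Prop := @TC k (@Stage k Q C).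

(* Left comodules over a subcoalgebra D of kQ.
   For a k-vector space M, kQ (x) M is represented by finitely supported
   functions  rpath Q -> M :  sum_p p (x) m_p  ~  (p |-> m_p).          *)
Section Comodules.
Variables (k : fieldType) (Q : quiver) (D : kQ k Q -> Prop).

Record precomod := PreComod {
  cM : lmodType k;
  coact : cM -> {malg cM[rpath Q]} }.
Arguments coact : clear implicits.

Definition ltens (M : lmodType k) (c : kQ k Q) (m : M) : {malg M[rpath Q]} :=
  \sum_(p <- msupp c) << c@_p *: m *g p >>.

Definition in_DtensM (M : lmodType k) (z : {malg M[rpath Q]}) : Prop :=
  exists s : seq (kQ k Q * M), (forall t, List.In t s -> D t.1) /\
    z = \sum_(t <- s) ltens t.1 t.2.

Definition is_comod (X : precomod) : Prop :=
  [/\ (forall a x y p, (coact X (a *: x + y))@_p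
                        = a *: (coact X x)@_p + (coact X y)@_p),
      (forall m, in_DtensM (coact X m)),
      (* (eps (x) id) o delta = id *)
      (forall m, \sum_(p <- msupp (coact X m) | p.2 == [::]) (coact X m)@_p = m) &
      (* (Delta (x) id) o delta = (id (x) delta) o delta, in kQ (x) kQ (x) X *)
      (forall m,
        \sum_(p <- msupp (coact X m)) \sum_(s <- splits p)
           << (coact X m)@_p *g s >>
        = \sum_(p <- msupp (coact X m))
            \sum_(q <- msupp (coact X ((coact X m)@_p)))
               << (coact X ((coact X m)@_p))@_q *g (p, q) >>)].

Definition is_hom (X Y : precomod) (f : cM X -> cM Y) : Prop :=
  (forall a x y, f (a *: x + y) = a *: f x + f y) /\
  (forall m p, (coact Y (f m))@_p = f ((coact X m)@_p)).

Definition is_epi (X Y : precomod) (e : cM X -> cM Y) : Prop :=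
  forall (Z : precomod) (g h : cM Y -> cM Z), is_comod Z ->
    is_hom g -> is_hom h -> (forall x, g (e x) = h (e x)) -> forall y, g y = h y.

Definition is_coproduct (G : precomod) (I : Type) (P : precomod)
    (u : I -> cM G -> cM P) : Prop :=
  [/\ is_comod P, (forall i, is_hom (u i)) &
      forall (Z : precomod) (f : I -> cM G -> cM Z), is_comod Z ->
        (forall i, is_hom (f i)) ->
        exists h : cM P -> cM Z,
          [/\ is_hom h, (forall i x, h (u i x) = f i x) &
              forall h' : cM P -> cM Z, is_hom h' ->
                (forall i x, h' (u i x) = f i x) -> forall y, h' y = h y]].

Definition is_generator (G : precomod) : Prop :=
  forall X : precomod, is_comod X ->
    exists (I : Type) (P : precomod) (u : I -> cM G -> cM P)
           (e : cM P -> cM X),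
      [/\ @is_coproduct G I P u, is_hom e & is_epi e].
End Comodules.

Lemma span_lin (k : fieldType) (V : lmodType k) (u v : V) a
    (s1 s2 : seq (k * V)) :
  u = \sum_(t <- s1) t.1 *: t.2 -> v = \sum_(t <- s2) t.1 *: t.2 ->
  a *: u + v = \sum_(t <- [seq (a * t.1, t.2) | t <- s1] ++ s2) t.1 *: t.2.
Proof.
move=> -> ->.
rewrite big_cat big_map /= scaler_sumr; congr (_ + _).
by apply: eq_bigr => t _; rewrite scalerA.
Qed.

Section TailComodule.
Variables (k : fieldType) (Q : quiver) (C : kQ k Q -> Prop).
Let TQ' := tail_quiver C.
Let V := kQ k TQ'.

(* linear span of T(C) (equal to T(C) when C is a subcoalgebra, T(C) being
   the union of a chain of subspaces); used to obtain a vector space *)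
Definition TCspan (x : V) : Prop :=
  exists s : seq (k * V), (forall t, List.In t s -> @tail_coalg k Q C t.2) /\
    x = \sum_(t <- s) t.1 *: t.2.

Definition TCpred : {pred V} := fun x => pb (TCspan x).

Lemma TCpred_closed : submod_closed TCpred.
Proof.
split.
  by apply/pbP; exists [::]; split => //; rewrite big_nil.
move=> a u v /pbP [s1 [H1 E1]] /pbP [s2 [H2 E2]]; apply/pbP.
exists ([seq (a * t.1, t.2) | t <- s1] ++ s2); split; last first.
  exact: (span_lin a E1 E2).
move=> t Ht; case: (List.in_app_or _ _ _ Ht) => [Hm|Hm]; last exact: H2.
have [t' [Et Ht']] := proj1 (List.in_map_iff _ _ _) Hm.
subst t; exact: (H1 t' Ht').
Qed.

HB.instance Definition _ :=
  GRing.isSubmodClosed.Build k V TCpred TCpred_closed.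

Record TCcar := TCin { TCval : V; _ : TCval \in TCpred }.
HB.instance Definition _ := [isSub for TCval].
HB.instance Definition _ := [Choice of TCcar by <:].
HB.instance Definition _ := [SubChoice_isSubLmodule of TCcar by <:].

Definition TCrow (x : V) (p : rpath TQ') : V :=
  \sum_(pq <- msupp (comult x) | pq.1 == p) << (comult x)@_pq *g pq.2 >>.

(* delta(x) = Delta(x) = sum_p p (x) row_p(x); the rows lie in T(C) when
   T(C) is a subcoalgebra (insubd only fixes the typing). *)
Definition TCcoact (x : TCcar) : {malg TCcar[rpath TQ']} :=
  \sum_(p <- undup [seq pq.1 | pq <- msupp (comult (val x))])
     << insubd (0 : TCcar) (TCrow (val x) p) *g p >>.

Definition tail_comodule : precomod k TQ' := @PreComod k TQ' TCcar TCcoact.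
End TailComodule.

(* Main.v *)
(* Let X be a left T(C)-comodule and x in X, with delta(x) = sum_j c_j (x) x_j.
   All c_j lie in some level C_N = T^N(C).  A set F of multipaths of C_N of least
   cardinality whose right quotients (the elements p / q) span a space
   containing every c_j is independent, so it gives a vertex e_F and an element
   q_F of C_(N+1).  Each p_i / q is read off q_F as the coefficient of the paths
   ending in q alpha_(i,F); hence there is a linear map f : kT(Q) -> X that only
   depends on coefficients of paths ending at e_F and that sends every left
   quotient p \ q_F to the corresponding coefficient of delta(x), and q_F to x.
   Such an f is a comodule map on T(C): apart from T^(N+1)(C), where this follows
   from the minimality of the bar construction, no level contributes new
   paths ending at e_F.  Every x being reached this way, a copower of T(C) indexed
   by X maps onto X. *)
Require Import Defs.
From HB Require Import structures.
From mathcomp Require Import all_boot all_algebra finmap.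
From mathcomp.multinomials Require Import monalg.
From Stdlib Require Import Classical ClassicalEpsilon.
Set Implicit Arguments. Unset Strict Implicit. Unset Printing Implicit Defensive.
Import GRing.Theory.
Local Open Scope fset_scope.
Local Open Scope ring_scope.

(** * Coefficients and sums of finitely supported functions *)

Lemma linear_fun0 (k : fieldType) (U V : lmodType k) (f : U -> V) :
  (forall a u v, f (a *: u + v) = a *: f u + f v) -> f 0 = 0.
Proof.
by move=> fL; apply: (addIr (f 0)); rewrite -[X in X + _]scale1r -fL scaler0 !add0r.
Qed.

Section Malg.
Variables (K : choiceType) (G : zmodType).
Implicit Types (g : {malg G[K]}).

Lemma sum_msupp_delta g x : \sum_(p <- msupp g) g@_p *+ (p == x) = g@_x.
Proof.
rewrite [in RHS](monalgE g) raddf_sum /=.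
by apply: eq_bigr => p _; rewrite mcoeffU.
Qed.

Lemma sum_msupp_widen (M : zmodType) (F : K -> G -> M) g (d : {fset K}) :
  (forall p, F p 0 = 0) -> msupp g `<=` d ->
  \sum_(p <- msupp g) F p g@_p = \sum_(p <- d) F p g@_p.
Proof.
move=> F0 gd; apply: big_fset_incl => // p _.
by move=> /mcoeff_outdom ->; rewrite F0.
Qed.
End Malg.

(** All three sums are moved to the union of the supports. The hypothesis on [g] is coefficientwise,
    so it makes sense without a scaling on [M]-valued functions. *)
Lemma sum_msupp_linear (k : fieldType) (K : choiceType) (M N : lmodType k)
    (F : K -> M -> N) (a : k) (g g1 g2 : {malg M[K]}) :
  (forall p b u v, F p (b *: u + v) = b *: F p u + F p v) ->
  (forall p, g@_p = a *: g1@_p + g2@_p) ->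
  \sum_(p <- msupp g) F p g@_p =
    a *: (\sum_(p <- msupp g1) F p g1@_p) + \sum_(p <- msupp g2) F p g2@_p.
Proof.
move=> Flin gE.
have F0 p : F p 0 = 0 by apply: linear_fun0; exact: Flin.
pose d := msupp g `|` (msupp g1 `|` msupp g2).
have sub h : h \in [:: msupp g; msupp g1; msupp g2] -> h `<=` d.
  rewrite !inE => /or3P [] /eqP ->; apply/fsubsetP => p pg;
  by rewrite !inE pg ?orbT.
rewrite !(@sum_msupp_widen _ _ _ _ _ d) ?sub ?inE ?eqxx ?orbT //.
rewrite scaler_sumr -big_split /=; apply: eq_bigr => p _.
by rewrite gE Flin.
Qed.

Section FieldCoef.
Variables (k : fieldType) (K : choiceType).
Implicit Types (x y : {malg k[K]}) (p : K).

Lemma coefZ a x p : (a *: x)@_p = a * x@_p.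
Proof. exact: mcoeffZ. Qed.
Lemma coefL a x y p : (a *: x + y)@_p = a * x@_p + y@_p.
Proof. by rewrite mcoeffD coefZ. Qed.
Lemma coefMn x n p : (x *+ n)@_p = x@_p *+ n.
Proof. exact: mcoeffMn. Qed.
Lemma coef_sum (I : Type) (s : seq I) (P : pred I) (F : I -> {malg k[K]}) p :
  (\sum_(i <- s | P i) F i)@_p = \sum_(i <- s | P i) (F i)@_p.
Proof. exact: raddf_sum. Qed.
End FieldCoef.

Section Slices.
Variables (K1 K2 : choiceType) (G : zmodType).
Implicit Types (z : {malg G[(K1 * K2)%type]}).

(** Row [p] of [z], seen as a matrix indexed by [K1] and [K2]; [slicer] gives the columns. *)
Definition slicel z (p : K1) : {malg G[K2]} :=
  \sum_(pq <- msupp z | pq.1 == p) << z@_pq *g pq.2 >>.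
Definition slicer z (q : K2) : {malg G[K1]} :=
  \sum_(pq <- msupp z | pq.2 == q) << z@_pq *g pq.1 >>.

Lemma slicelE z p q : (slicel z p)@_q = z@_(p, q).
Proof.
rewrite /slicel raddf_sum /= -(sum_msupp_delta z (p, q)) big_mkcond /=.
apply: eq_bigr => -[p' q'] _ /=; rewrite mcoeffU xpair_eqE.
by case: (p' == p).
Qed.

Lemma slicerE z p q : (slicer z q)@_p = z@_(p, q).
Proof.
rewrite /slicer raddf_sum /= -(sum_msupp_delta z (p, q)) big_mkcond /=.
apply: eq_bigr => -[p' q'] _ /=; rewrite mcoeffU xpair_eqE andbC.
by case: (q' == q).
Qed.
End Slices.

(** * Concatenation and cutting of paths *)

Section Paths.
Variable Q : quiver.
Implicit Types (p q r : rpath Q).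

Definition pcat p q : rpath Q := (p.1, p.2 ++ q.2).
Definition composable p q : bool := q.1 == ptarget p.

Lemma ptarget_pcat p q : composable p q -> ptarget (pcat p q) = ptarget q.
Proof. by move/eqP; rewrite /ptarget /pcat /= map_cat last_cat => ->. Qed.

Lemma composable_pcat_l p q r :
  composable p q -> composable (pcat p q) r = composable q r.
Proof. by move=> pq; rewrite /composable ptarget_pcat. Qed.

Lemma composable_pcat_r p q r : composable p (pcat q r) = composable p q.
Proof. by []. Qed.

Lemma pcatA p q r : pcat (pcat p q) r = pcat p (pcat q r).
Proof. by rewrite /pcat /= catA. Qed.

Lemma valid_from_cat (v : qV Q) (s1 s2 : seq (qA Q)) :
  valid_from v (s1 ++ s2) =
  valid_from v s1 && valid_from (last v (map (@qt Q) s1)) s2.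
Proof. by elim: s1 v => //= a s IH v; rewrite IH andbA. Qed.

Lemma valid_pcat p q : composable p q -> valid (pcat p q) = valid p && valid q.
Proof. by move/eqP; rewrite /valid /= valid_from_cat /ptarget => ->. Qed.

(** The cut of [r] after [size p.2] arrows is the only one that can give [(p, q)]. Composability
    enters because the second half of a cut starts at the target of the first. *)
Lemma sum_splits (G : zmodType) (r p q : rpath Q) (x : G) :
  \sum_(s <- splits r) x *+ (s == (p, q)) =
    x *+ (composable p q && (r == pcat p q)).
Proof.
rewrite /splits big_map.
have E i : i \in iota 0 (size r.2).+1 ->
  (((r.1, take i r.2), (ptarget (r.1, take i r.2), drop i r.2)) == (p, q))
  = (i == size p.2) && (composable p q && (r == pcat p q)).
  rewrite mem_iota /= ltnS => ir; case: p q r ir => [pv ps] [qv qs] [rv rs].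
  rewrite /composable /pcat /= => ir; apply/eqP/idP.
    case=> -> <- -> <-; rewrite size_take_min (minn_idPl ir) eqxx /=.
    by rewrite cat_take_drop !eqxx.
  move=> /and3P [/eqP -> /eqP -> /eqP [-> ->]].
  by rewrite take_size_cat // drop_size_cat.
rewrite (eq_big_seq _ (fun i h => congr1 (fun b : bool => x *+ b) (E i h))).
case: andP => [[_ /eqP ->]|_] /=; last first.
  by rewrite mulr0n big1 // => i _; rewrite andbF.
have sp : size p.2 \in iota 0 (size (p.2 ++ q.2)).+1.
  by rewrite mem_iota ltnS size_cat leq_addr.
rewrite (bigD1_seq _ sp) ?iota_uniq //=.
by rewrite eqxx big1 ?addr0 // => i /negbTE ->.
Qed.

(** Coefficients are arbitrary: with scalars this computes [comult], with values in a comodule it is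
    one side of coassociativity. *)
Lemma coef_splits (G : zmodType) (c : {malg G[rpath Q]}) p q :
  (\sum_(r <- msupp c) \sum_(s <- splits r) << c@_r *g s >>)@_(p, q)
  = c@_(pcat p q) *+ composable p q.
Proof.
rewrite raddf_sum /= -(sum_msupp_delta c) -sumrMnl.
apply: eq_bigr => r _; rewrite raddf_sum /=.
under eq_bigr => s _ do rewrite mcoeffU.
by rewrite sum_splits mulrnAC -mulrnA; case: composable; case: eqP.
Qed.
End Paths.

(** * Left and right quotients of elements of the path coalgebra *)

Section RowCol.
Variables (k : fieldType) (Q : quiver).
Implicit Types (x y z : kQ k Q) (p q r : rpath Q).

Lemma comultE x p q : (comult x)@_(p, q) = x@_(pcat p q) *+ composable p q.
Proof. exact: coef_splits. Qed.

(* [lquo x p] is p \ x and [rquo x q] is x / q.  They are opaque because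
   unification would otherwise try to unfold the sums. *)
Lemma lquo_spec x p :
  {y : kQ k Q | forall q, y@_q = x@_(pcat p q) *+ composable p q}.
Proof. by exists (slicel (comult x) p) => q; rewrite slicelE comultE. Qed.

Lemma rquo_spec x q :
  {y : kQ k Q | forall p, y@_p = x@_(pcat p q) *+ composable p q}.
Proof. by exists (slicer (comult x) q) => p; rewrite slicerE comultE. Qed.

Definition lquo x p : kQ k Q := sval (lquo_spec x p).
Definition rquo x q : kQ k Q := sval (rquo_spec x q).

Lemma lquoE x p q : (lquo x p)@_q = x@_(pcat p q) *+ composable p q.
Proof. exact: (svalP (lquo_spec x p)). Qed.

Lemma rquoE x p q : (rquo x q)@_p = x@_(pcat p q) *+ composable p q.
Proof. exact: (svalP (rquo_spec x q)). Qed.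

Lemma tensE x y p q : (tens x y)@_(p, q) = x@_p * y@_q.
Proof.
rewrite /tens raddf_sum /= -(sum_msupp_delta x) mulr_suml.
apply: eq_bigr => p' _; rewrite raddf_sum /= -(sum_msupp_delta y) mulr_sumr.
apply: eq_bigr => q' _; rewrite mcoeffU xpair_eqE.
by case: (p' == p); case: (q' == q); rewrite /= ?mulr0 ?mul0r.
Qed.

(** Coassociativity in coordinates, by associativity of concatenation. The same computation gives
    [rquo_rquo] and the commutation of left with right quotients in [lquo_rquo]. *)
Lemma lquo_lquo x p q : lquo (lquo x p) q = lquo x (pcat p q) *+ composable p q.
Proof.
apply/malgP => r; rewrite !lquoE [RHS]coefMn lquoE -pcatA -!mulrnA.
congr (GRing.natmul _ _).
rewrite !mulnb composable_pcat_r; case pq : (composable p q); last by rewrite andbF.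
by rewrite composable_pcat_l ?andbT.
Qed.

Lemma rquo_rquo x p q : rquo (rquo x q) p = rquo x (pcat p q) *+ composable p q.
Proof.
apply/malgP => r; rewrite !rquoE [RHS]coefMn rquoE
  pcatA -!mulrnA.
congr (GRing.natmul _ _).
rewrite !mulnb composable_pcat_r; case rp : (composable r p);
  last by rewrite /= andbF.
by rewrite composable_pcat_l ?andbT.
Qed.

Lemma lquo_rquo x p q : lquo (rquo x q) p = rquo (lquo x p) q.
Proof.
apply/malgP => r; rewrite lquoE rquoE [RHS]rquoE lquoE
  pcatA -!mulrnA.
congr (GRing.natmul _ _).
rewrite !mulnb composable_pcat_r; case pr : (composable p r); last by rewrite andbF.
by rewrite composable_pcat_l ?andbT.
Qed.

Lemma lquo_triv x v q : (lquo x (trivp v))@_q = x@_q *+ (q.1 == v).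
Proof.
rewrite lquoE /composable /ptarget /= /pcat /=.
by case: eqP => [<-|//]; case: q.
Qed.

Lemma rquo_triv x w p : (rquo x (trivp w))@_p = x@_p *+ (w == ptarget p).
Proof. by rewrite rquoE /composable /pcat /= cats0; case: p. Qed.

Lemma lquo_linear a x y p : lquo (a *: x + y) p = a *: lquo x p + lquo y p.
Proof.
by apply/malgP => q; rewrite lquoE !coefL !lquoE mulrnDl mulrnAr.
Qed.

Lemma rquo_linear a x y p : rquo (a *: x + y) p = a *: rquo x p + rquo y p.
Proof.
by apply/malgP => q; rewrite rquoE !coefL !rquoE mulrnDl mulrnAr.
Qed.

(** Quotients by trivial paths sort the paths of [x] by source. *)
Lemma sum_lquo_triv x (d : {fset qV Q}) : (forall p, p \in msupp x -> p.1 \in d) ->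
  x = \sum_(v <- d) lquo x (trivp v).
Proof.
move=> xd; apply/malgP => q; rewrite coef_sum.
under eq_bigr => v _ do rewrite lquo_triv.
have [xq|/mcoeff_outdom ->] := boolP (q \in msupp x); last first.
  by rewrite big1 // => i _; rewrite mul0rn.
rewrite (big_fsetD1 q.1) ?xd //= eqxx big1_fset ?addr0 // => v.
by rewrite in_fsetD1 eq_sym; case: eqP.
Qed.

Lemma sum_rquo_triv x (d : {fset qV Q}) :
  (forall p, p \in msupp x -> ptarget p \in d) ->
  x = \sum_(v <- d) rquo x (trivp v).
Proof.
move=> xd; apply/malgP => q; rewrite coef_sum.
under eq_bigr => v _ do rewrite rquo_triv.
have [xq|/mcoeff_outdom ->] := boolP (q \in msupp x); last first.
  by rewrite big1 // => i _; rewrite mul0rn.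
rewrite (big_fsetD1 (ptarget q)) ?xd //= eqxx big1_fset ?addr0 // => v.
by rewrite in_fsetD1; case: eqP.
Qed.

Lemma subspace_sum (C : kQ k Q -> Prop) (I : eqType) (s : seq I) (P : pred I)
    (F : I -> kQ k Q) : subspace C -> (forall i, i \in s -> P i -> C (F i)) ->
  C (\sum_(i <- s | P i) F i).
Proof.
move=> [C0 CL]; elim: s => [|i s IH] H; first by rewrite big_nil.
rewrite big_cons; have Cs : C (\sum_(j <- s | P j) F j).
  by apply: IH => j js; apply: H; rewrite inE js orbT.
case: ifP => // Pi; rewrite -[F i]scale1r; apply: CL => //.
by apply: H => //; rewrite inE eqxx.
Qed.

Lemma subspaceZ (C : kQ k Q -> Prop) a x : subspace C -> C x -> C (a *: x).
Proof. by move=> [C0 CL] Cx; rewrite -[_ *: _]addr0; apply: CL. Qed.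

Lemma subspaceMn (C : kQ k Q -> Prop) x n : subspace C -> C x -> C (x *+ n).
Proof. by move=> CS Cx; rewrite -scaler_nat; apply: subspaceZ. Qed.

(* Z *m pinvmx Z *m Z = Z factors the coefficient matrix Z of z through
   combinations of its own rows and columns. *)
Lemma in_tensor_slices (C D : kQ k Q -> Prop) (z : kQ2 k Q) :
  subspace C -> subspace D ->
  (forall q, C (slicer z q)) -> (forall p, D (slicel z p)) -> in_tensor C D z.
Proof.
move=> CS DS Cz Dz.
pose P := undup [seq pq.1 | pq <- msupp z].
pose R := undup [seq pq.2 | pq <- msupp z].
pose Pi (i : 'I_(size P)) := tnth (in_tuple P) i.
pose Rj (j : 'I_(size R)) := tnth (in_tuple R) j.
pose Z := \matrix_(i, j) z@_(Pi i, Rj j).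
pose s := [seq (slicer z (Rj j), \sum_i pinvmx Z j i *: slicel z (Pi i))
          | j <- enum 'I_(size R)].
exists s; split.
  move=> t /List.in_map_iff [j [<- _]]; split => //=.
  by apply: subspace_sum => // i _ _; apply: subspaceZ.
apply/malgP => -[p q]; rewrite (raddf_sum (mcoeff (p, q))) big_map big_enum /=.
have E : forall j, (tens (slicer z (Rj j))
    (\sum_i pinvmx Z j i *: slicel z (Pi i)))@_(p, q) =
    z@_(p, Rj j) * \sum_i pinvmx Z j i * z@_(Pi i, q).
  move=> j; rewrite tensE slicerE coef_sum; congr (_ * _).
  by apply: eq_bigr => i _; rewrite coefZ slicelE.
under eq_bigr => j _ do rewrite E.
have [pP|pP] := boolP (p \in P); last first.
  have z0 q' : z@_(p, q') = 0.
    apply: mcoeff_outdom; apply: contra pP => h.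
    by rewrite mem_undup; apply/mapP; exists (p, q').
  by rewrite z0 big1 // => j _; rewrite z0 mul0r.
have [qR|qR] := boolP (q \in R); last first.
  have z0 p' : z@_(p', q) = 0.
    apply: mcoeff_outdom; apply: contra qR => h.
    by rewrite mem_undup; apply/mapP; exists (p', q).
  rewrite z0 big1 // => j _; rewrite big1 ?mulr0 // => i _.
  by rewrite z0 mulr0.
have [a Ea] : exists a, p = Pi a.
  by apply/tnthP.
have [b Eb] : exists b, q = Rj b by apply/tnthP.
have := mulmxKpV (submx_refl Z) => /matrixP /(_ a b).
rewrite -mulmxA !mxE -Ea -Eb => <-; apply: eq_bigr => j _.
rewrite !mxE -Ea; congr (_ * _); apply: eq_bigr => i _.
by rewrite !mxE -Eb.
Qed.
End RowCol.

(** * Subcoalgebras, generated right coideals and independent sets *)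

Section Subcoalgebras.
Variables (k : fieldType) (Q : quiver).
Implicit Types (x y z : kQ k Q) (p q r : rpath Q) (C D I W : kQ k Q -> Prop).

Lemma slicel_comult x p : slicel (comult x) p = lquo x p.
Proof. by apply/malgP => q; rewrite slicelE comultE lquoE. Qed.

Lemma slicer_comult x q : slicer (comult x) q = rquo x q.
Proof. by apply/malgP => p; rewrite slicerE comultE rquoE. Qed.

Lemma subspaceL C a x y : subspace C -> C x -> C y -> C (a *: x + y).
Proof. by case=> _; apply. Qed.

Lemma subspace_preim C (f : kQ k Q -> kQ k Q) : subspace C ->
  (forall a x y, f (a *: x + y) = a *: f x + f y) -> subspace (fun x => C (f x)).
Proof.
move=> CS fL; split=> [|a x y Cx Cy]; last by rewrite fL; apply: subspaceL.
rewrite (linear_fun0 fL); by case: CS.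
Qed.

Lemma lquo_tensor (s : seq (kQ k Q * kQ k Q)) x p :
  comult x = \sum_(t <- s) tens t.1 t.2 ->
  lquo x p = \sum_(t <- s) t.1@_p *: t.2.
Proof.
move=> E; rewrite -slicel_comult; apply/malgP => q.
rewrite slicelE E !coef_sum; apply: eq_bigr => t _.
by rewrite tensE coefZ.
Qed.

Lemma rquo_tensor (s : seq (kQ k Q * kQ k Q)) x q :
  comult x = \sum_(t <- s) tens t.1 t.2 ->
  rquo x q = \sum_(t <- s) t.2@_q *: t.1.
Proof.
move=> E; rewrite -slicer_comult; apply/malgP => p.
rewrite slicerE E !coef_sum; apply: eq_bigr => t _.
by rewrite tensE coefZ mulrC.
Qed.

(** Taking the coefficient at [p] in the left factors of a decomposition leaves a linear combination
    of its right factors. *)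
Lemma in_tensor_lquo C D x p :
  subspace D -> in_tensor C D (comult x) -> D (lquo x p).
Proof.
move=> DS [s [Hs /lquo_tensor ->]].
elim: s Hs => [|t s IH] H; first by rewrite big_nil; case: DS.
rewrite big_cons; apply: subspaceL => //; first by case: (H t (or_introl erefl)).
by apply: IH => t' ht'; apply: H; right.
Qed.

Lemma in_tensor_rquo C D x q :
  subspace C -> in_tensor C D (comult x) -> C (rquo x q).
Proof.
move=> CS [s [Hs /rquo_tensor ->]].
elim: s Hs => [|t s IH] H; first by rewrite big_nil; case: CS.
rewrite big_cons; apply: subspaceL => //; first by case: (H t (or_introl erefl)).
by apply: IH => t' ht'; apply: H; right.
Qed.

Lemma in_tensor_comult C D x : subspace C -> subspace D ->
  (forall q, C (rquo x q)) -> (forall p, D (lquo x p)) -> in_tensor C D (comult x).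
Proof.
move=> CS DS Cx Dx; apply: in_tensor_slices => // p.
  by rewrite slicer_comult.
by rewrite slicel_comult.
Qed.

(** Trades the tensor condition for closure under both quotients, which passes easily to
    intersections and unions of chains. One direction evaluates a decomposition, the other rebuilds
    one from rows and columns. *)
Lemma subcoalgebraP C : subcoalgebra C <->
  [/\ forall x, C x -> in_kQ x, subspace C,
      forall x p, C x -> C (lquo x p) & forall x q, C x -> C (rquo x q)].
Proof.
split=> [[C1 [C2 C3]]|[C1 C2 C3 C4]].
  split=> // x p Cx; first exact: in_tensor_lquo C2 (C3 x Cx).
  exact: in_tensor_rquo C2 (C3 x Cx).
by split=> //; split=> // x Cx; apply: in_tensor_comult => // p; auto.
Qed.

Lemma sum_trivial_lquo x (d : {fset rpath Q}) :
  (forall v, lquo x (trivp v) != 0 -> trivp v \in d) ->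
  \sum_(p <- d | p.2 == [::]) lquo x p = x.
Proof.
move=> xd; apply/malgP => q; rewrite coef_sum.
have E p : p.2 == [::] -> (lquo x p)@_q = x@_q *+ (q.1 == p.1).
  by case: p => v s /= /eqP ->; rewrite -lquo_triv.
rewrite (eq_bigr _ E).
have [->|nz] := eqVneq x@_q 0; first by rewrite big1 // => p _; rewrite mul0rn.
have qd : trivp q.1 \in d.
  apply: xd; apply: contra_neq nz => c0.
  by have := lquo_triv x q.1 q; rewrite c0 eqxx mcoeff0 => /esym.
rewrite big_mkcond (bigD1_seq (trivp q.1)) ?fset_uniq //= eqxx big1 ?addr0 //.
move=> [v s] /= vq; case: eqP => // s0; case: eqP => // qv.
by rewrite qv s0 eqxx in vq.
Qed.

(** The span as the intersection of all subspaces containing [A]; a membership proof is thus an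
    induction principle, to be applied to a suitable subspace [W]. *)
Definition kspan (A : kQ k Q -> Prop) y :=
  forall W, subspace W -> (forall x, A x -> W x) -> W y.

Lemma kspan_subspace A : subspace (kspan A).
Proof.
split=> [W [W0 _] _ //|a x y Ax Ay W WS WA].
by apply: subspaceL => //; [apply: Ax|apply: Ay].
Qed.

Lemma kspan_incl (A : kQ k Q -> Prop) x : A x -> kspan A x.
Proof. by move=> Ax W _; apply. Qed.

(** For [A] inside a subcoalgebra this is the right coideal generated by [A]. *)
Definition rquospan (A : kQ k Q -> Prop) :=
  kspan (fun y => exists x q, A x /\ y = rquo x q).

Lemma rquospan_subspace A : subspace (rquospan A).
Proof. exact: kspan_subspace. Qed.

Lemma rquo_rquospan A x q : rquospan A x -> rquospan A (rquo x q).
Proof.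
move=> /(_ (fun z => rquospan A (rquo z q))) H; apply: H => [|_ [y [q' [Ay ->]]]].
    apply: (subspace_preim (rquospan_subspace A)).
    by move=> *; exact: rquo_linear.
rewrite rquo_rquo; apply: (subspaceMn _ (rquospan_subspace _)).
by apply: kspan_incl; exists y, (pcat q q').
Qed.

(** [x] is the sum of its right quotients by the trivial paths at the targets of its paths. *)
Lemma subspace_rquo_closed C x : subspace C -> (forall q, C (rquo x q)) -> C x.
Proof.
move=> CS Cx.
rewrite [x](@sum_rquo_triv _ _ _ [fset (ptarget p) | p in msupp x]).
  by apply: subspace_sum.
by move=> p px; apply: in_imfset.
Qed.

Lemma rquospan_self (A : kQ k Q -> Prop) x : A x -> rquospan A x.
Proof.
move=> Ax; apply: (subspace_rquo_closed (rquospan_subspace _)) => q.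
by apply: kspan_incl; exists x, q.
Qed.

Lemma rquospan_coideal C A : subcoalgebra C -> (forall x, A x -> C x) ->
  right_coideal C (rquospan A).
Proof.
move=> /subcoalgebraP [C1 C2 C3 C4] AC.
have sub x : rquospan A x -> C x.
  by apply=> // _ [y [q [Ay ->]]]; apply/C4/AC.
split=> //; split=> [|x Ax]; first exact: rquospan_subspace.
apply: in_tensor_comult => //; first exact: rquospan_subspace.
  by move=> q; apply: rquo_rquospan.
by move=> p; apply/C3/sub.
Qed.

(** The generated right coideal is the smallest one, and the span of the right quotients of [x] is a
    right coideal containing [x]. *)
Lemma in_gen_rcoideal_rquospan C x y : subcoalgebra C -> C x ->
  in_gen_rcoideal C x y -> rquospan (eq x) y.
Proof.
move=> CC Cx; apply; last exact: rquospan_self.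
by apply: rquospan_coideal => // _ <-.
Qed.

Definition mem_fset (F : {fset kQ k Q}) x : Prop := x \in F.

Lemma rquospan_mono (A B : kQ k Q -> Prop) y :
  (forall x q, A x -> rquospan B (rquo x q)) -> rquospan A y -> rquospan B y.
Proof.
move=> AB; apply; first exact: rquospan_subspace.
by move=> _ [x [q [Ax ->]]]; apply: AB.
Qed.

(** Cut every [c] by the sources and targets of its paths. The pieces are quotients by trivial paths
    on both sides, so they stay in [C]; the nonzero ones are multipaths and add up to [c]. *)
Lemma multipath_decomposition C (cs : seq (kQ k Q)) : subcoalgebra C ->
  (forall c, c \in cs -> C c) ->
  exists F : {fset kQ k Q}, (forall x, x \in F -> C x /\ multipath x) /\
    forall c, c \in cs -> rquospan (mem_fset F) c.
Proof.
move=> /subcoalgebraP [C1 C2 C3 C4] Ccs.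
pose src (c : kQ k Q) := [fset p.1 | p in msupp c].
pose tgt (c : kQ k Q) := [fset (ptarget p) | p in msupp c].
pose piece (c : kQ k Q) v w : kQ k Q := lquo (rquo c (trivp w)) (trivp v).
pose pieces c := [seq piece c v w | v <- enum_fset (src c), w <- enum_fset (tgt c)].
pose F : {fset kQ k Q} := [fset x in flatten (map pieces cs) | x != 0].
have coefp c v w p : (piece c v w)@_p = c@_p *+ (w == ptarget p) *+ (p.1 == v).
  by rewrite lquo_triv rquo_triv.
exists F; split=> [x|c ccs].
  rewrite !inE => /andP [/flattenP [_ /mapP [c ccs ->]]].
  move=> /allpairsP [[v w] /= [_ _ ->]] nz.
  have Cc := Ccs _ ccs; split; first by apply/C3/C4.
  split=> //; exists v, w => p; rewrite -mcoeff_neq0 coefp.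
  case: (eqVneq w (ptarget p)) => [->|_]; last by rewrite mulr0n mul0rn eqxx.
  case: (eqVneq p.1 v) => [<-|_]; last by rewrite mulr0n eqxx.
  by rewrite !mulr1n mcoeff_neq0 => /(C1 _ Cc).
rewrite [c](@sum_rquo_triv _ _ _ (tgt c)); last first.
  by move=> p pc; apply: in_imfset.
apply: (subspace_sum (rquospan_subspace _)) => w wt _.
rewrite [rquo _ _](@sum_lquo_triv _ _ _ (src c)); last first.
  move=> p; rewrite -mcoeff_neq0 rquo_triv => h; apply: in_imfset => /=.
  by rewrite -mcoeff_neq0; apply: contraNneq h => ->; rewrite mul0rn.
apply: (subspace_sum (rquospan_subspace _)) => v vs _.
have [->|nz] := eqVneq (lquo (rquo c (trivp w)) (trivp v)) 0.
  by case: (rquospan_subspace (mem_fset F)).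
apply: rquospan_self; rewrite /mem_fset !inE nz andbT.
apply/flattenP; exists (pieces c); first exact: map_f.
by apply/allpairsP; exists (v, w).
Qed.

(** Minimal cardinality forces independence: given a linear relation in [F], or an element of [F] in
    the coideal of another one, some element could be dropped without losing any [c]. *)
Lemma exists_independent C (cs : seq (kQ k Q)) : subcoalgebra C ->
  (forall c, c \in cs -> C c) ->
  exists F : {fset kQ k Q}, independent C F /\
    forall c, c \in cs -> rquospan (mem_fset F) c.
Proof.
move=> CC Ccs.
pose good (F : {fset kQ k Q}) := (forall x, x \in F -> C x /\ multipath x) /\
    forall c, c \in cs -> rquospan (mem_fset F) c.
have ex : exists n, pb (exists F, good F /\ #|` F| = n).
  have [F gF] := multipath_decomposition CC Ccs.
  by exists #|` F|; apply/pbP; exists F.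
case: (ex_minnP ex) => n /pbP [F [[F1 F2] Fn]] Fmin.
(* Otherwise [F] without [y] would still span every [c] in [cs], with fewer elements. *)
have Fred y : y \in F ->
    ~ (forall q, rquospan (mem_fset (F `\ y)) (rquo y q)).
  move=> yF yspan; have : (n <= #|` F `\ y|)%N.
    apply: Fmin; apply/pbP; exists (F `\ y); split=> //; split=> [x|c ccs].
      by rewrite !inE => /andP [_ /F1].
    apply: rquospan_mono (F2 _ ccs) => x q xF.
    have [->//|xy] := eqVneq x y; apply: kspan_incl; exists x, q; split=> //.
    by rewrite /mem_fset !inE xy.
  by rewrite -Fn (cardfsD1 y F) yF ltnn.
have colS y : subspace (fun z => forall q, rquospan (mem_fset (F `\ y)) (rquo z q)).
  split=> [q|a u v hu hv q].
    have -> : rquo (0 : kQ k Q) q = 0.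
      by apply/malgP => p; rewrite rquoE !mcoeff0 mul0rn.
    by case: (rquospan_subspace (mem_fset (F `\ y))).
  by rewrite rquo_linear; apply: (subspaceL _ (rquospan_subspace _)).
have inS y x : x \in F -> x != y ->
    forall q, rquospan (mem_fset (F `\ y)) (rquo x q).
  move=> xF xy q; apply: kspan_incl; exists x, q; split=> //.
  by rewrite /mem_fset !inE xy.
exists F; split=> //; split=> //; split=> [c c0 y yF|x y xF yF xy].
  apply/eqP; apply/negPn/negP => cy; apply: (Fred y yF).
  (* The linear relation is solved for [y], whose coefficient is nonzero. *)
  have E : y = \sum_(x <- F `\ y) (- (c y)^-1 * c x) *: x.
    under eq_bigr => x _ do rewrite -scalerA.
    rewrite -scaler_sumr; move: c0; rewrite (big_fsetD1 y) //= => /eqP.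
    rewrite addr_eq0 => /eqP E; rewrite scaleNr -scalerN -E scalerA.
    by rewrite mulVf // scale1r.
  rewrite {2}E => q.
  move: (subspace_sum (s := F `\ y) (P := xpredT)
    (F := fun x => (- (c y)^-1 * c x) *: x) (colS y)).
  apply=> x; rewrite !inE => /andP [xy xF] _.
  by apply: (subspaceZ _ (colS y)); exact: inS.
apply/eqP; apply/negPn/negP => yx; apply: (Fred y yF).
(* [y] is a combination of right quotients of [x], so its own right quotients are too; they survive
   the removal of [y] because [x] differs from [y]. *)
have := in_gen_rcoideal_rquospan CC (proj1 (F1 x xF)) xy.
move=> /(_ _ (colS y)) H; apply: H => _ [_ [q [<- ->]]] q'; rewrite rquo_rquo.
apply: (subspaceMn _ (rquospan_subspace _)).
by apply: inS => //; rewrite eq_sym.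
Qed.
End Subcoalgebras.

(** * Pushforward along embeddings of quivers *)

Record qmor (Q Q' : quiver) := QMor {
  mV : qV Q -> qV Q'; mA : qA Q -> qA Q';
  mV_inj : injective mV; mA_inj : injective mA;
  mV_s : forall a, qs (mA a) = mV (qs a);
  mV_t : forall a, qt (mA a) = mV (qt a) }.

Section Pushforward.
Variables (k : fieldType) (Q Q' : quiver) (f : qmor Q Q').
Implicit Types (x y : kQ k Q) (p q r : rpath Q).

Definition pmap p : rpath Q' := (mV f p.1, map (mA f) p.2).

Lemma pmap_inj : injective pmap.
Proof.
move=> [v s] [w t] [/(@mV_inj _ _ f) -> /(inj_map (@mA_inj _ _ f)) ->] //.
Qed.

Lemma ptarget_pmap p : ptarget (pmap p) = mV f (ptarget p).
Proof.
case: p => v s; rewrite /ptarget /pmap /=.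
elim: s v => //= a s IH v; by rewrite mV_t IH.
Qed.

Lemma composable_pmap p q : composable (pmap p) (pmap q) = composable p q.
Proof. by rewrite /composable ptarget_pmap /= (inj_eq (@mV_inj _ _ f)). Qed.

Lemma pcat_pmap p q : pcat (pmap p) (pmap q) = pmap (pcat p q).
Proof. by rewrite /pcat /pmap /= map_cat. Qed.

Lemma valid_pmap p : valid (pmap p) = valid p.
Proof.
case: p => v s; rewrite /valid /=.
elim: s v => //= a s IH v; by rewrite mV_s mV_t IH (inj_eq (@mV_inj _ _ f)).
Qed.

(** Factors of an embedded path are embedded: cut the arrow list of [r] after [size s'] arrows.
    Composability fixes the starting vertex of the second factor. *)
Lemma pcat_eq_pmap (p' q' : rpath Q') r : composable p' q' -> pcat p' q' = pmap r ->
  exists p q, [/\ p' = pmap p, q' = pmap q & r = pcat p q].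
Proof.
case: p' q' r => [v' s'] [w' t'] [v u].
rewrite /composable /pcat /= => /eqP -> [-> E].
exists (v, take (size s') u), (ptarget (v, take (size s') u), drop (size s') u).
have Es : s' = map (mA f) (take (size s') u) by rewrite map_take -E take_size_cat.
have Et : t' = map (mA f) (drop (size s') u) by rewrite map_drop -E drop_size_cat.
split; last by rewrite /pcat /= cat_take_drop.
  by rewrite /pmap /= -Es.
by rewrite /pmap /= -Et -ptarget_pmap /pmap /= -Es.
Qed.

Lemma push_spec x :
  {y : kQ k Q' | y = \sum_(p <- msupp x) << x@_p *g pmap p >>}.
Proof. by eexists. Qed.

Definition push x : kQ k Q' := sval (push_spec x).

Lemma pushE x : push x = \sum_(p <- msupp x) << x@_p *g pmap p >>.
Proof. exact: (svalP (push_spec x)). Qed.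

Lemma push_pmap x p : (push x)@_(pmap p) = x@_p.
Proof.
rewrite pushE coef_sum -[RHS]sum_msupp_delta.
by apply: eq_bigr => q _; rewrite mcoeffU (inj_eq pmap_inj).
Qed.

Lemma push_out x (r : rpath Q') : (forall p, r <> pmap p) -> (push x)@_r = 0.
Proof.
move=> rP; rewrite pushE coef_sum big1 // => p _; rewrite mcoeffU.
by case: eqP => // /esym /rP.
Qed.

Lemma pmapP (r : rpath Q') : (exists p, r = pmap p) \/ (forall p, r <> pmap p).
Proof.
case: (classic (exists p, r = pmap p)) => [|h]; [by left|right => p rp].
by apply: h; exists p.
Qed.

Lemma push_linear a x y : push (a *: x + y) = a *: push x + push y.
Proof.
apply/malgP => r; rewrite coefL; case: (pmapP r) => [[p ->]|rP].
  by rewrite !push_pmap coefL.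
by rewrite !push_out // mulr0 addr0.
Qed.

Lemma lquo_push x p : lquo (push x) (pmap p) = push (lquo x p).
Proof.
apply/malgP => r; rewrite lquoE.
case: (pmapP r) => [[q ->]|rP];
  first by rewrite pcat_pmap !push_pmap lquoE composable_pmap.
rewrite (push_out _ rP); case pr : (composable (pmap p) r); last by rewrite mulr0n.
rewrite push_out // => q /(pcat_eq_pmap pr) [p1 [q1 [_ rq _]]].
by case: (rP q1).
Qed.

(** A path outside the image is not a prefix of any embedded path. *)
Lemma lquo_push_out x (r : rpath Q') :
  (forall p, r <> pmap p) -> lquo (push x) r = 0.
Proof.
move=> rP; apply/malgP => q; rewrite lquoE mcoeff0.
case pr : (composable r q); last by rewrite mulr0n.
rewrite push_out // => q' /(pcat_eq_pmap pr) [p1 [q1 [E _ _]]].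
by case: (rP p1).
Qed.

Lemma rquo_push x q : rquo (push x) (pmap q) = push (rquo x q).
Proof.
apply/malgP => r; rewrite rquoE.
case: (pmapP r) => [[p ->]|rP];
  first by rewrite pcat_pmap !push_pmap rquoE composable_pmap.
rewrite (push_out _ rP); case pr : (composable r (pmap q)); last by rewrite mulr0n.
rewrite push_out // => p /(pcat_eq_pmap pr) [p1 [q1 [rp _ _]]].
by case: (rP p1).
Qed.

Lemma rquo_push_out x (r : rpath Q') :
  (forall q, r <> pmap q) -> rquo (push x) r = 0.
Proof.
move=> rP; apply/malgP => p; rewrite rquoE mcoeff0.
case pr : (composable p r); last by rewrite mulr0n.
rewrite push_out // => q' /(pcat_eq_pmap pr) [p1 [q1 [_ E _]]].
by case: (rP q1).
Qed.

Lemma in_kQ_push x : in_kQ x -> in_kQ (push x).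
Proof.
move=> xv r; rewrite -mcoeff_neq0; case: (pmapP r) => [[p ->]|rP].
  by rewrite push_pmap valid_pmap mcoeff_neq0 => /xv.
by rewrite push_out ?eqxx.
Qed.
End Pushforward.

(** * The coalgebra of all combinations of valid paths *)

Section InKQ.
Variables (k : fieldType) (Q : quiver).
Implicit Types (x y : kQ k Q) (p q r : rpath Q).

Lemma in_kQP x : in_kQ x <-> forall p, ~~ valid p -> x@_p = 0.
Proof.
split=> xv p; first by move=> pv; apply: mcoeff_outdom; apply: contra pv => /xv.
by rewrite -mcoeff_neq0; apply: contra_neqT => /xv.
Qed.

Lemma in_kQ_subspace : subspace (@in_kQ k Q).
Proof.
split=> [|a x y /in_kQP xv /in_kQP yv]; apply/in_kQP => p pv; first exact: mcoeff0.
by rewrite coefL xv // yv // mulr0 addr0.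
Qed.

Lemma in_kQ_lquo x p : in_kQ x -> in_kQ (lquo x p).
Proof.
move=> /in_kQP xv; apply/in_kQP => q qv; rewrite lquoE.
case pq : (composable p q); last by rewrite mulr0n.
by rewrite xv // valid_pcat // negb_and qv orbT.
Qed.

Lemma in_kQ_rquo x q : in_kQ x -> in_kQ (rquo x q).
Proof.
move=> /in_kQP xv; apply/in_kQP => p pv; rewrite rquoE.
case pq : (composable p q); last by rewrite mulr0n.
by rewrite xv // valid_pcat // negb_and pv.
Qed.

Lemma in_kQ_subcoalgebra : subcoalgebra (@in_kQ k Q).
Proof.
apply/subcoalgebraP; split => //; first exact: in_kQ_subspace.
  by move=> *; exact: in_kQ_lquo.
by move=> *; exact: in_kQ_rquo.
Qed.
End InKQ.

(** * The bar construction *)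

Section BarStage.
Variables (k : fieldType) (S : stage k).
Let Q := sQ S.
Let Q' : quiver := barQ S.

Fact inlV_inj : injective (@inl (qV Q) (newV S) : qV Q -> qV Q').
Proof. by move=> x y []. Qed.
Fact inlA_inj : injective (@inl (qA Q) (newA S) : qA Q -> qA Q').
Proof. by move=> x y []. Qed.

Definition bar_mor : qmor Q Q' :=
  @QMor Q Q' inl inl inlV_inj inlA_inj (fun _ => erefl) (fun _ => erefl).

Lemma embkE (x : kQ k Q) : embk x = push bar_mor x.
Proof. by rewrite pushE. Qed.

(** Induction along the path: its tail starts at an old vertex, and an arrow with old target is
    old. *)
Lemma old_path (p : rpath Q') v : valid p -> ptarget p = inl v ->
  exists p0 : rpath Q, p = pmap bar_mor p0.
Proof.
case: p => w s; elim: s w => [|a s IH] w /=.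
  by rewrite /ptarget /= => _ ->; exists (v, [::]).
rewrite /valid /ptarget /= => /andP [/eqP <-] va tl.
have [[w' s'] /= [Ew ->]] := IH (qt a) va tl.
case: a Ew {va tl IH} => [a|[F i]] //= _.
by exists (qs a, a :: s').
Qed.

(** A new vertex is a sink: new arrows start at the target of a multipath, which is old. The default
    in [bars] is excluded because a multipath is nonzero. *)
Lemma no_arrow_from_new (p : rpath Q') F :
  valid p -> p.1 = inr F -> p = trivp (inr F : qV Q').
Proof.
case: p => w [|a s] //= vp E; first by rewrite E.
move: vp; rewrite /valid /= E; case: a => [a|[F' i]] //= /andP [/eqP].
have Fm : msupp (Fp i) != fset0.
  have /pbP [Fi _] := valP F'.
  have /Fi [_ [nz _]] : Fp i \in val F' by rewrite /Fp mem_nth.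
  apply: contra nz => /eqP s0; apply/eqP/malgP => p.
  by rewrite mcoeff0 mcoeff_outdom // s0.
case Ei : (enum_fset (msupp (Fp i))) => [|p t] //.
by move: Fm; rewrite -cardfs_eq0 Ei.
Qed.

(** [bars] reads the target off one path of the support, and all paths of a multipath share it. *)
Lemma bars_new F (i : 'I_#|` val F|) (p : rpath Q) : p \in msupp (Fp i) ->
  bars (inr (existT _ F i) : barA S) = inl (ptarget p).
Proof.
move=> pi /=.
have /pbP [Fi _] := valP F.
have /Fi [_ [nz [v [w H]]]] : Fp i \in val F by rewrite /Fp mem_nth.
case Ei : (enum_fset (msupp (Fp i))) => [|p' t].
  by move: pi; rewrite -[p \in _]/(p \in enum_fset _) Ei.
have p'i : p' \in msupp (Fp i).
  by rewrite -[p' \in _]/(p' \in enum_fset _) Ei inE eqxx.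
by have [_ [_ ->]] := H _ pi; have [_ [_ ->]] := H _ p'i.
Qed.

(** The path p alpha_(i,F); q_F is a combination of such paths. *)
Definition tailp F (i : 'I_#|` val F|) (p : rpath Q) : rpath Q' :=
  (inl p.1, rcons (map inl p.2) (inr (existT _ F i))).

Lemma tailp_inj F i F' i' p p' :
  @tailp F i p = @tailp F' i' p' -> F = F' /\ p = p'.
Proof.
case: p p' => [v s] [v' s'] [-> /rcons_inj [/(inj_map inlA_inj) -> E]].
by split=> //; case: E.
Qed.

Lemma tailp_inj_ord F i i' p p' : @tailp F i p = @tailp F i' p' -> i = i'.
Proof.
case: p p' => [v s] [v' s'] [_ /rcons_inj [_ E]].
by move: E => [] /eqP; rewrite -/(Tagged _ i) eq_Tagged => /eqP.
Qed.

(** Tail paths with different [i] or [p] are different, so the summands of q_F do not interfere. *)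
Lemma qF_tailp F (i : 'I_#|` val F|) p : (qF F)@_(tailp i p) = (Fp i)@_p.
Proof.
rewrite /qF coef_sum (bigD1 i) //= [X in _ + X]big1 ?addr0 => [|j ji].
  rewrite coef_sum -[RHS]sum_msupp_delta; apply: eq_bigr => q _.
  rewrite mcoeffU; congr (_ *+ nat_of_bool _).
  by apply/eqP/eqP => [/tailp_inj []|->].
rewrite coef_sum big1 // => q _; rewrite mcoeffU; case: eqP => // /tailp_inj_ord.
by move/eqP; rewrite (negbTE ji).
Qed.

Lemma qF_out F (r : rpath Q') :
  (forall i p, r <> @tailp F i p) -> (qF F)@_r = 0.
Proof.
move=> rP; rewrite /qF coef_sum big1 // => i _; rewrite coef_sum big1 // => p _.
by rewrite mcoeffU; case: eqP => // /esym /rP.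
Qed.

Lemma tailpP F (r : rpath Q') :
  (exists i p, r = @tailp F i p) \/ (forall i p, r <> @tailp F i p).
Proof.
case: (classic (exists i p, r = @tailp F i p)) => [|h]; [by left|right=> i p E].
by apply: h; exists i, p.
Qed.

Lemma ptarget_tailp F i p : ptarget (@tailp F i p) = inr F.
Proof. by rewrite /ptarget /= map_rcons last_rcons. Qed.
End BarStage.

Section BarCoalgebra.
Variables (k : fieldType) (S : stage k).
Hypothesis SC : subcoalgebra (@sC k S).
Let Q := sQ S.
Let Q' : quiver := barQ S.
Let emb := bar_mor S.

Lemma tailp_pcat F (i : 'I_#|` val F|) (p : rpath Q) :
  tailp i p = pcat (pmap emb p) (arrowp (inr (existT _ F i) : qA Q')).
Proof. by rewrite /tailp /pcat /= cats1. Qed.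

Lemma pcat_tailp F (i : 'I_#|` val F|) (p q : rpath Q) :
  pcat (pmap emb p) (tailp i q) = tailp i (pcat p q).
Proof. by rewrite /tailp /pcat /= map_cat rcons_cat. Qed.

Lemma composable_tail_arrow F (i : 'I_#|` val F|) p : p \in msupp (Fp i) ->
  composable (pmap emb p) (arrowp (inr (existT _ F i) : qA Q')).
Proof.
by move=> pi; rewrite /composable ptarget_pmap; apply/eqP; exact: bars_new pi.
Qed.

Lemma in_kQ_qF F : in_kQ (@qF k S F).
Proof.
have /pbP [Fi _] := valP F.
move=> r; rewrite -mcoeff_neq0; case: (tailpP F r) => [[i [p ->]]|h].
  rewrite qF_tailp mcoeff_neq0 => pi.
  have /Fi [_ [_ [v [w /(_ _ pi) [vp _]]]]] : Fp i \in val F by rewrite /Fp mem_nth.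
  rewrite tailp_pcat valid_pcat ?composable_tail_arrow // valid_pmap vp /=.
  by rewrite /valid /= eqxx.
by rewrite qF_out // eqxx.
Qed.

Lemma barC_embk x : sC x -> barC (push emb x).
Proof. by move=> Cx D _ H _; rewrite -[push _ _]embkE; apply: H. Qed.

Lemma barC_qF F : @barC k S (qF F).
Proof. by move=> D _ _; apply. Qed.

(** Closure under quotients passes to intersections, and the coalgebra of all valid paths is one of
    the subcoalgebras intersected. *)
Lemma bar_subcoalgebra : subcoalgebra (@barC k S).
Proof.
have [SC1 _ _ _] := proj1 (subcoalgebraP _) SC.
apply/subcoalgebraP; split.
- move=> x; apply; first exact: in_kQ_subcoalgebra.
    by move=> y /SC1; rewrite embkE; exact: in_kQ_push.
  exact: in_kQ_qF.
- split=> [D /subcoalgebraP [_ [] //]|a x y xC yC D DC DS DF].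
  have [_ DL _ _] := proj1 (subcoalgebraP _) DC.
  by apply: subspaceL => //; [apply: xC|apply: yC].
- move=> x p xC D DC DS DF.
  by have [_ _ Dl _] := proj1 (subcoalgebraP _) DC; apply: Dl; apply: xC.
- move=> x p xC D DC DS DF.
  by have [_ _ _ Dr] := proj1 (subcoalgebraP _) DC; apply: Dr; apply: xC.
Qed.

(** Discarding the paths outside the old quiver takes [z] into the old coalgebra. This brings
    elements down one level. *)
Definition restricts (z : kQ k Q') : Prop :=
  exists c, sC c /\ forall r : rpath Q, z@_(pmap emb r) = c@_r.

Lemma restricts_subspace : subspace restricts.
Proof.
have [_ [S0 SL] _ _] := proj1 (subcoalgebraP _) SC.
split=> [|a x y [c [Cc xc]] [d [Cd yd]]].
  by exists 0; split=> // r; rewrite !mcoeff0.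
by exists (a *: c + d); split=> [|r]; [exact: SL|rewrite !coefL xc yd].
Qed.

(** In a valid path, what precedes an old path ends at an old vertex and is therefore old; so
    quotients by other paths restrict to 0. *)
Lemma restricts_lquo z p : in_kQ z -> restricts z -> restricts (lquo z p).
Proof.
have [_ SS Sl _] := proj1 (subcoalgebraP _) SC.
move=> /in_kQP zv [c [Cc zc]]; case: (pmapP emb p) => [[p' ->]|pP].
  exists (lquo c p'); split=> [|r]; first exact: Sl.
  by rewrite !lquoE pcat_pmap composable_pmap zc.
exists 0; split=> [|r]; first by case: SS.
rewrite lquoE mcoeff0; case pr : (composable p (pmap emb r));
  last by rewrite mulr0n.
rewrite zv // valid_pcat // negb_and; apply/orP; left; apply/negP => vp.
have [p0 /pP //] := old_path vp (esym (eqP pr)).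
Qed.

(** On old paths, q_F / (q0 alpha_(i,F)) is p_i / q0, which lies in the old coalgebra; all other
    quotients restrict to 0. *)
Lemma restricts_rquo_qF F q : restricts (rquo (qF F) q).
Proof.
have [_ SS _ Sr] := proj1 (subcoalgebraP _) SC.
case: (tailpP F q) => [[i [q0 ->]]|qP].
  exists (rquo (Fp i) q0); split=> [|r].
    apply: Sr; have /pbP [Fi _] := valP F.
    by have /Fi [] : Fp i \in val F by rewrite /Fp mem_nth.
  rewrite !rquoE pcat_tailp qF_tailp; congr (_ *+ nat_of_bool _).
  by rewrite /composable ptarget_pmap /= (inj_eq (@inlV_inj _ S)).
exists 0; split=> [|r]; first by case: SS.
rewrite rquoE mcoeff0; case rq : (composable _ q); last by rewrite mulr0n.
(* If [q] is trivial, an old path would end in a new arrow. Otherwise [q] ends in that new arrow,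
   and removing the old prefix [r] exhibits [q] as a tail path. *)
rewrite qF_out // => i p; case: q qP rq => w s; case/lastP: s => [|s a] qP /eqP /=.
  rewrite /pcat /= cats0 => _ [_ E].
  have : (inr (existT _ F i) : qA Q') \in map inl r.2.
    by rewrite E mem_rcons inE eqxx.
  by case/mapP.
rewrite ptarget_pmap /= => wE; rewrite /pcat /tailp /= => -[_].
rewrite -rcons_cat => /rcons_inj [E aE].
apply: (qP i (ptarget r, drop (size r.2) p.2)).
rewrite /tailp /= wE aE; congr (_, rcons _ _).
by rewrite map_drop -E drop_size_cat // size_map.
Qed.

(* The invariant asks all right quotients to restrict, since the property of
   restricting into the old coalgebra is not itself stable under right
   quotients by new paths. *)
Lemma bar_restricts z : barC z -> restricts z.
Proof.
have [SC1 SS _ Sr] := proj1 (subcoalgebraP _) SC.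
pose D (z : kQ k Q') := in_kQ z /\ forall q, restricts (rquo z q).
suff H : forall z, barC z -> D z.
  move=> /H [_ h]; exact: subspace_rquo_closed restricts_subspace h.
move=> {}z; apply.
- apply/subcoalgebraP; split=> [x []//||x p [xv xr]|x q [xv xr]].
  + split=> [|a x y [xv xr] [yv yr]]; split.
    * by case: (@in_kQ_subspace k Q').
    * move=> q; have -> : rquo (0 : kQ k Q') q = 0.
        by apply/malgP => p; rewrite rquoE !mcoeff0 mul0rn.
      by case: restricts_subspace.
    * by apply: (subspaceL _ (@in_kQ_subspace k Q')).
    * by move=> q; rewrite rquo_linear; apply: (subspaceL _ restricts_subspace).
  + split=> [|q]; first exact: in_kQ_lquo.
    by rewrite -lquo_rquo; apply: restricts_lquo => //; exact: in_kQ_rquo.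
  + split=> [|q']; first exact: in_kQ_rquo.
    by rewrite rquo_rquo; apply: (subspaceMn _ restricts_subspace).
- move=> x Cx; rewrite embkE; split=> [|q]; first exact/in_kQ_push/SC1.
  case: (pmapP emb q) => [[q0 ->]|qP].
    rewrite rquo_push; exists (rquo x q0); split=> [|r]; first exact: Sr.
    by rewrite push_pmap.
  by rewrite rquo_push_out //; case: restricts_subspace.
- by move=> F; split=> [|q]; [exact: in_kQ_qF|exact: restricts_rquo_qF].
Qed.
End BarCoalgebra.

(** * The tail closure *)

Section Tail.
Variables (k : fieldType) (S0 : stage k).
Hypothesis SC0 : subcoalgebra (@sC k S0).
Notation Qn n := (sQ (iter_bar S0 n)).
Notation Cn n := (@sC k (iter_bar S0 n)).
Let T : quiver := TQ S0.

Lemma iter_bar_subcoalgebra n : subcoalgebra (Cn n).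
Proof. by elim: n => //= n IH; exact: bar_subcoalgebra. Qed.

(** Minimality of the bar construction, phrased as an induction principle for level [n.+1]. *)
Lemma iter_bar_min n (D : kQ k (Qn n.+1) -> Prop) z : Cn n.+1 z ->
  subcoalgebra D ->
  (forall x, Cn n x -> D (push (bar_mor (iter_bar S0 n)) x)) ->
  (forall F, D (qF F)) -> D z.
Proof.
by move=> Cz DC DS DF; apply: Cz => // x Cx; rewrite embkE; exact: DS.
Qed.

(** A vertex tagged [m] is created in passing from level [m] to level [m.+1]. *)
Lemma embV_new n v m F : @embV k S0 n v = inr (existT _ m F) -> (m < n)%N.
Proof.
elim: n v => //= n IH [v /IH /ltnW|F' [E _]]; first by rewrite ltnS.
by rewrite E.
Qed.

Lemma embA_new n a m b : @embA k S0 n a = inr (existT _ m b) -> (m < n)%N.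
Proof.
elim: n a => //= n IH [a /IH /ltnW|b' [E _]]; first by rewrite ltnS.
by rewrite E.
Qed.

Lemma embV_inj n : injective (@embV k S0 n).
Proof.
elim: n => [v w []//|n IH] [v|F] [w|F'] /=.
- by move=> h; rewrite (IH _ _ h).
- by move/embV_new; rewrite ltnn.
- by move/esym/embV_new; rewrite ltnn.
(* Both vertices are created at the same level: strip [inr], then compare the tagged pairs. The
   default of this projection is not reached. *)
move/(congr1 (fun u : TV S0 => if u is inr w then w else existT _ n F)).
by move=> /(@eq_from_Tagged _ (fun n => newV (iter_bar S0 n))) ->.
Qed.

Lemma embA_inj n : injective (@embA k S0 n).
Proof.
elim: n => [v w []//|n IH] [v|F] [w|F'] /=.
- by move=> h; rewrite (IH _ _ h).
- by move/embA_new; rewrite ltnn.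
- by move/esym/embA_new; rewrite ltnn.
move/(congr1 (fun u : TA S0 => if u is inr w then w else existT _ n F)).
by move=> /(@eq_from_Tagged _ (fun n => newA (iter_bar S0 n))) ->.
Qed.

Lemma embA_s n (a : qA (Qn n)) : Ts (@embA k S0 n a) = @embV k S0 n (qs a).
Proof. by elim: n a => //= n IH [a|b] //=. Qed.

Lemma embA_t n (a : qA (Qn n)) : Tt (@embA k S0 n a) = @embV k S0 n (qt a).
Proof. by elim: n a => //= n IH [a|b] //=. Qed.

Definition T_mor n : qmor (Qn n) T :=
  @QMor (Qn n) T (@embV k S0 n) (@embA k S0 n) (@embV_inj n) (@embA_inj n)
    (@embA_s n) (@embA_t n).

Lemma embKE n (x : kQ k (Qn n)) : embK x = push (T_mor n) x.
Proof. by rewrite pushE. Qed.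

Lemma pmap_T_bar n (p : rpath (Qn n)) :
  pmap (T_mor n.+1) (pmap (bar_mor (iter_bar S0 n)) p) = pmap (T_mor n) p.
Proof. by rewrite /pmap /= -map_comp. Qed.

Lemma push_T_bar n (x : kQ k (Qn n)) :
  push (T_mor n.+1) (push (bar_mor (iter_bar S0 n)) x) = push (T_mor n) x.
Proof.
apply/malgP => r; case: (pmapP (T_mor n) r) => [[p ->]|rP].
  by rewrite push_pmap -pmap_T_bar !push_pmap.
rewrite (push_out _ rP).
case: (pmapP (T_mor n.+1) r) => [[p rp]|rP']; last by rewrite push_out.
rewrite rp push_pmap push_out // => p' E; apply: (rP p').
by rewrite rp E pmap_T_bar.
Qed.

Definition TCn n (x : kQ k T) : Prop := exists c, Cn n c /\ x = push (T_mor n) c.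

Lemma TCP x : @TC k S0 x <-> exists n, TCn n x.
Proof.
split=> [[n [c [Cc ->]]]|[n [c [Cc ->]]]]; first by exists n, c; rewrite embKE.
by exists n, c; rewrite embKE.
Qed.

Lemma TCn_mono n m x : (n <= m)%N -> TCn n x -> TCn m x.
Proof.
move=> nm Tx; elim: m nm => [|m IH]; first by rewrite leqn0 => /eqP <-.
rewrite leq_eqVlt => /orP [/eqP <- //|]; rewrite ltnS => /IH [c [Cc ->]].
exists (push (bar_mor (iter_bar S0 m)) c); rewrite push_T_bar; split=> //.
exact: barC_embk.
Qed.

(** Union of a chain: two elements are moved to the larger of their levels. Quotients by paths of a
    level are taken there, and all others are 0. *)
Lemma TC_subcoalgebra : subcoalgebra (@TC k S0).
Proof.
apply/subcoalgebraP; split.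
- move=> x /TCP [n [c [Cc ->]]]; apply: in_kQ_push.
  by case: (proj1 (subcoalgebraP _) (iter_bar_subcoalgebra n)) => H _ _ _; exact: H.
- split=> [|a x y /TCP [n Tx] /TCP [m Ty]].
    apply/TCP; exists 0%N, 0; split; last first.
      by apply/malgP => r; rewrite pushE msupp0 big_seq_fset0.
    by case: SC0 => _ [[]].
  have [c [Cc ->]] := TCn_mono (leq_maxl n m) Tx.
  have [d [Cd ->]] := TCn_mono (leq_maxr n m) Ty.
  apply/TCP; exists (maxn n m), (a *: c + d); rewrite push_linear; split=> //.
  by case: (iter_bar_subcoalgebra (maxn n m)) => _ [[_ H] _]; exact: H.
- move=> x p /TCP [n [c [Cc ->]]].
  have [_ [C0 _] H _] := proj1 (subcoalgebraP _) (iter_bar_subcoalgebra n).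
  case: (pmapP (T_mor n) p) => [[p0 ->]|pP].
    by rewrite lquo_push; apply/TCP; exists n, (lquo c p0); split=> //; exact: H.
  rewrite lquo_push_out //; apply/TCP; exists n, 0; split=> //.
  by rewrite pushE msupp0 big_seq_fset0.
- move=> x p /TCP [n [c [Cc ->]]].
  have [_ [C0 _] _ H] := proj1 (subcoalgebraP _) (iter_bar_subcoalgebra n).
  case: (pmapP (T_mor n) p) => [[p0 ->]|pP].
    by rewrite rquo_push; apply/TCP; exists n, (rquo c p0); split=> //; exact: H.
  rewrite rquo_push_out //; apply/TCP; exists n, 0; split=> //.
  by rewrite pushE msupp0 big_seq_fset0.
Qed.
End Tail.

(** * Comodules and copowers *)

Local Notation coaction X := (@coact _ _ X).

Section ComoduleTheory.
Variables (k : fieldType) (Q : quiver) (D : kQ k Q -> Prop).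

Lemma coef_ltens (M : lmodType k) (c : kQ k Q) (m : M) p :
  (ltens c m)@_p = c@_p *: m.
Proof.
rewrite /ltens raddf_sum /= -(sum_msupp_delta c) scaler_suml.
by apply: eq_bigr => q _; rewrite mcoeffU scalerMnl.
Qed.

Lemma in_DtensMP (M : lmodType k) (z : {malg M[rpath Q]}) : in_DtensM D z <->
  exists s : seq (kQ k Q * M), (forall t, List.In t s -> D t.1) /\
    forall p, z@_p = \sum_(t <- s) t.1@_p *: t.2.
Proof.
split=> [[s [sD ->]]|[s [sD zE]]]; exists s; split=> //.
  by move=> p; rewrite raddf_sum /=; apply: eq_bigr => t _; rewrite coef_ltens.
apply/malgP => p; rewrite zE raddf_sum /=.
by apply: eq_bigr => t _; rewrite coef_ltens.
Qed.

Lemma in_DtensM_sum (M : lmodType k) (I : Type) (r : seq I)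
    (F : I -> {malg M[rpath Q]}) :
  (forall i, in_DtensM D (F i)) -> in_DtensM D (\sum_(i <- r) F i).
Proof.
move=> FD; elim: r => [|i r [s [sD E]]].
  by rewrite big_nil; exists [::]; split=> //; rewrite big_nil.
have [s' [s'D E']] := FD i; exists (s' ++ s); rewrite big_cons big_cat E E'.
by split=> // t /List.in_app_iff [/s'D|/sD].
Qed.

(** Only the summand at [p] matters; [F 0 = 0] covers the case of [p] outside the support of [c]. *)
Lemma coef_iterated (M : zmodType) (K : choiceType) (c : {malg M[K]})
    (F : M -> {malg M[K]}) p q : F 0 = 0 ->
  (\sum_(p' <- msupp c) \sum_(q' <- msupp (F c@_p'))
      << (F c@_p')@_q' *g (p', q') >>)@_(p, q) = (F c@_p)@_q.
Proof.
move=> F0; rewrite raddf_sum /=.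
have E p' : (\sum_(q' <- msupp (F c@_p')) << (F c@_p')@_q' *g (p', q') >>)@_(p, q)
    = (F c@_p')@_q *+ (p' == p).
  rewrite raddf_sum /= -(sum_msupp_delta (F c@_p')) -sumrMnl.
  apply: eq_bigr => q' _; rewrite mcoeffU xpair_eqE.
  by case: (p' == p); case: (q' == q).
under eq_bigr => p' _ do rewrite E.
have [pc|/mcoeff_outdom c0] := boolP (p \in msupp c).
  rewrite (big_fsetD1 p) //= eqxx big1_fset ?addr0 // => p'.
  by rewrite in_fsetD1; case: eqP.
rewrite c0 F0 mcoeff0 big1 // => p' _; case: eqP => [->|//].
by rewrite c0 F0 mcoeff0.
Qed.

Lemma linear_coact0 (X : precomod k Q) :
  (forall a x y p, (coaction X (a *: x + y))@_p
                    = a *: (coaction X x)@_p + (coaction X y)@_p) ->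
  coaction X 0 = 0.
Proof.
move=> cL; apply/malgP => p; rewrite mcoeff0.
by apply: (linear_fun0 (f := fun x => (coaction X x)@_p)) => *; exact: cL.
Qed.

(** Coassociativity read on coefficients: taking the coefficient at [p] and then at [q] amounts to
    taking it at their concatenation, the same rule as for left quotients. *)
Lemma is_comodP (X : precomod k Q) : is_comod D X <->
  [/\ (forall a x y p, (coaction X (a *: x + y))@_p
                        = a *: (coaction X x)@_p + (coaction X y)@_p),
      (forall m, in_DtensM D (coaction X m)),
      (forall m, \sum_(p <- msupp (coaction X m) | p.2 == [::])
                    (coaction X m)@_p = m) &
      (forall m p q, (coaction X ((coaction X m)@_p))@_q =
          (coaction X m)@_(pcat p q) *+ composable p q)].
Proof.
split=> -[cL cD c1 cA]; split=> // m; have c0 := linear_coact0 cL.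
  by move=> p q; rewrite -coef_splits cA coef_iterated.
by apply/malgP => -[p q]; rewrite coef_splits coef_iterated.
Qed.

Lemma counit_widen (X : precomod k Q) m (d : {fset rpath Q}) : is_comod D X ->
  msupp (coaction X m) `<=` d ->
  \sum_(p <- d | p.2 == [::]) (coaction X m)@_p = m.
Proof.
case=> _ _ c1 _ md; rewrite -[RHS]c1 big_mkcond [RHS]big_mkcond /=.
rewrite -(sum_msupp_widen (F := fun p g => if p.2 == [::] then g else 0) _ md) //.
by move=> p; case: ifP.
Qed.

Lemma coact0 (X : precomod k Q) : is_comod D X -> coaction X 0 = 0.
Proof. by case=> /linear_coact0. Qed.

Lemma surjective_epi (X Y : precomod k Q) (e : cM X -> cM Y) :
  (forall y, exists x, e x = y) -> is_epi D e.
Proof. by move=> es Z g h _ _ _ gh y; have [x <-] := es y. Qed.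
End ComoduleTheory.

(* An alias, since {malg M[I]} is a left module in the library only when M is
   the ring of scalars. *)
Definition copower (k : fieldType) (I : choiceType) (M : lmodType k) :=
  {malg M[I]}.

Section Copower.
Variables (k : fieldType) (I : choiceType) (M : lmodType k).
Implicit Types (g : copower I M).

HB.instance Definition _ := GRing.Zmodule.on (copower I M).

Definition copower_scale (a : k) g : copower I M :=
  \sum_(i <- msupp g) << a *: g@_i *g i >>.

Lemma copower_scaleE a g i : (copower_scale a g)@_i = a *: g@_i.
Proof.
rewrite /copower_scale raddf_sum /= -(sum_msupp_delta g) scaler_sumr.
by apply: eq_bigr => j _; rewrite mcoeffU scalerMnr.
Qed.

Fact copower_scaleA a b g :
  copower_scale a (copower_scale b g) = copower_scale (a * b) g.
Proof. by apply/malgP => i; rewrite !copower_scaleE scalerA. Qed.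

Fact copower_scale1 : left_id 1 copower_scale.
Proof. by move=> g; apply/malgP => i; rewrite copower_scaleE scale1r. Qed.

Fact copower_scaleDr : right_distributive copower_scale +%R.
Proof.
by move=> a g h; apply/malgP => i; rewrite mcoeffD !copower_scaleE mcoeffD scalerDr.
Qed.

Fact copower_scaleDl g : {morph copower_scale^~ g : a b / a + b}.
Proof.
by move=> a b; apply/malgP => i; rewrite mcoeffD !copower_scaleE scalerDl.
Qed.

HB.instance Definition _ := GRing.Zmodule_isLmodule.Build k (copower I M)
  copower_scaleA copower_scale1 copower_scaleDr copower_scaleDl.

Lemma copower_coefL a (g h : copower I M) i :
  (a *: g + h)@_i = a *: g@_i + h@_i.
Proof. by rewrite mcoeffD copower_scaleE. Qed.
End Copower.

Section CopowerComodule.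
Variables (k : fieldType) (Q : quiver) (D : kQ k Q -> Prop).
Variables (G : precomod k Q) (I : choiceType).
Hypothesis Gcomod : is_comod D G.
Let P := copower I (cM G).

(** The direct sum coaction: each copy of [G] coacts within itself. *)
Definition copower_coact (y : P) : {malg P[rpath Q]} :=
  \sum_(i <- msupp y) \sum_(p <- msupp (coaction G y@_i))
     << (<< (coaction G y@_i)@_p *g i >> : P) *g p >>.

Definition copower_comod : precomod k Q := PreComod copower_coact.

Definition copower_in (i : I) (g : cM G) : P := << g *g i >>.

Lemma copower_coactE (y : P) p i :
  ((copower_coact y)@_p : P)@_i = (coaction G y@_i)@_p.
Proof.
have G0 := coact0 Gcomod.
rewrite /copower_coact raddf_sum /= raddf_sum /=.
have E j : ((\sum_(q <- msupp (coaction G y@_j))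
     << (<< (coaction G y@_j)@_q *g j >> : P) *g q >>)@_p : P)@_i
     = (coaction G y@_j)@_p *+ (j == i).
  rewrite raddf_sum /= raddf_sum /= -(sum_msupp_delta (coaction G y@_j)) -sumrMnl.
  apply: eq_bigr => q _; rewrite mcoeffU mcoeffMn mcoeffU.
  by case: (q == p); case: (j == i).
under eq_bigr => j _ do rewrite E.
have [yi|/mcoeff_outdom yi] := boolP (i \in msupp y).
  rewrite (big_fsetD1 i) //= eqxx big1_fset ?addr0 // => j.
  by rewrite in_fsetD1; case: eqP.
rewrite yi G0 mcoeff0 big1 // => j _; case: eqP => [->|//].
by rewrite yi G0 mcoeff0.
Qed.

Lemma copower_sum (y : P) : y = \sum_(i <- msupp y) copower_in i y@_i.
Proof. exact: monalgE. Qed.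

Lemma copower_comodP : is_comod D copower_comod.
Proof.
have [cL cD c1 cA] := proj1 (is_comodP D G) Gcomod.
have PE (y : P) p i : ((coaction copower_comod y)@_p : P)@_i = (coaction G y@_i)@_p.
  exact: copower_coactE.
apply/is_comodP; split.
- move=> a x y p; apply/malgP => i.
  by rewrite PE [RHS]copower_coefL !PE copower_coefL cL.
- move=> y.
  (* Membership in the tensor space is not checked coordinatewise, so [y] is first split into its
     finitely many components. *)
  have -> : coaction copower_comod y =
      \sum_(i <- msupp y) copower_coact (copower_in i y@_i).
    apply/malgP => p; apply/malgP => i; rewrite PE.
    rewrite raddf_sum /= raddf_sum /=.
    under eq_bigr => j _ do rewrite copower_coactE mcoeffU.
    have [yi|/mcoeff_outdom yi] := boolP (i \in msupp y).
      rewrite (big_fsetD1 i) //= eqxx big1_fset ?addr0 // => j.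
      by rewrite in_fsetD1; case: eqP => //; rewrite (coact0 Gcomod) mcoeff0.
    rewrite yi (coact0 Gcomod) mcoeff0 big1 // => j _; case: eqP => [->|_];
    by rewrite ?yi ?mulr0n (coact0 Gcomod) mcoeff0.
  apply: in_DtensM_sum => i.
  have /in_DtensMP [s [sD E]] := cD y@_i.
  apply/in_DtensMP; exists [seq (t.1, copower_in i t.2) | t <- s]; split.
    by move=> t /List.in_map_iff [t' [<- /sD]].
  move=> p; apply/malgP => j; rewrite copower_coactE big_map raddf_sum /=.
  rewrite mcoeffU; case: (eqVneq i j) => [<-|ij].
    rewrite mulr1n E; apply: eq_bigr => t _.
    by rewrite copower_scaleE mcoeffUU.
  rewrite mulr0n (coact0 Gcomod) mcoeff0 big1 // => t _.
  by rewrite copower_scaleE mcoeffU (negbTE ij) mulr0n scaler0.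
- move=> y; apply/malgP => i; rewrite raddf_sum /=.
  under eq_bigr => p _ do rewrite PE.
  (* One coordinate of the coaction may have a smaller support than the whole, so the counit law of
     [G] is used over the larger set. *)
  apply: (counit_widen Gcomod); apply/fsubsetP => p.
  rewrite -!mcoeff_neq0 -copower_coactE; apply: contraNneq.
  by move=> E; rewrite [copower_coact y]/(coaction copower_comod y) E mcoeff0.
move=> y p q; apply/malgP => i; rewrite PE PE cA [RHS]mcoeffMn.
by rewrite PE.
Qed.

Lemma copower_in_hom i : is_hom (X := G) (Y := copower_comod) (copower_in i).
Proof.
have [cL _ _ _] := Gcomod; split=> [a x y|g p].
  apply/malgP => j; rewrite copower_coefL !mcoeffU.
  by case: (i == j); rewrite ?mulr1n // !mulr0n scaler0 addr0.
apply/malgP => j; rewrite [LHS]copower_coactE !mcoeffU.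
by case: (i == j); rewrite ?mulr1n // !mulr0n (coact0 Gcomod) mcoeff0.
Qed.

(** The mediating map adds up the [f i] over the coordinates; it is unique because every element is
    a sum of images of the [copower_in i]. *)
Lemma copower_coproduct : is_coproduct D (G := G) (P := copower_comod) copower_in.
Proof.
split=> [||Z f Zc fh]; [exact: copower_comodP|exact: copower_in_hom|].
have [ZL _ _ _] := Zc.
have f0 i : f i 0 = 0 by have [fL _] := fh i; exact: linear_fun0 fL.
pose h (y : P) := \sum_(i <- msupp y) f i y@_i.
have hL a (x y : P) : h (a *: x + y) = a *: h x + h y.
  apply: (sum_msupp_linear (F := f)) => [i b u v|i]; first by case: (fh i).
  exact: copower_coefL.
have coact_sum (J : Type) (s : seq J) (F : J -> cM Z) p :
    (coaction Z (\sum_(j <- s) F j))@_p = \sum_(j <- s) (coaction Z (F j))@_p.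
  elim: s => [|j s IH]; first by rewrite !big_nil (coact0 Zc) mcoeff0.
  by rewrite !big_cons -[F j]scale1r ZL !scale1r IH.
exists h; split.
- split=> // y p; rewrite coact_sum /h.
  under eq_bigr => i _ do rewrite (proj2 (fh i)) -copower_coactE.
  (* The coaction may kill coordinates but creates none, so both sums can run over the support of
     [y]. *)
  have sub : msupp ((coaction copower_comod y)@_p : P) `<=` msupp y.
    apply/fsubsetP => i; rewrite -!mcoeff_neq0 [X in X != _]copower_coactE.
    by apply: contraNneq => ->; rewrite (coact0 Gcomod) mcoeff0.
  by rewrite (sum_msupp_widen (F := fun i g => f i g) f0 sub).
- move=> i g; rewrite /h msuppU; case: eqP => [->|_].
    by rewrite big_seq_fset0 f0.
  by rewrite big_seq_fset1 mcoeffUU.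
move=> h' [h'L _] h'u y; rewrite [in LHS](copower_sum y) /h.
have h'0 : h' 0 = 0 := linear_fun0 h'L.
elim: (enum_fset (msupp y)) => [|i s IH]; first by rewrite !big_nil.
by rewrite !big_cons -[copower_in i _]scale1r h'L IH scale1r h'u.
Qed.
End CopowerComodule.

Lemma eq_bigr_In (V : zmodType) (I : Type) (s : seq I) (F G : I -> V) :
  (forall i, List.In i s -> F i = G i) -> \sum_(i <- s) F i = \sum_(i <- s) G i.
Proof.
elim: s => [|i s IH] FG; first by rewrite !big_nil.
rewrite !big_cons FG; last by left.
by rewrite IH // => j js; apply: FG; right.
Qed.

(** * The tail closure as a left comodule over itself *)

Section TailComoduleTheory.
Variables (k : fieldType) (Q : quiver) (C : kQ k Q -> Prop).
Hypothesis CC : subcoalgebra C.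
Let S0 : stage k := @Stage k Q C.
Let T : quiver := tail_quiver C.
Implicit Types (x : TCcar C) (p q : rpath T).

Lemma tail_coalg_subcoalgebra : subcoalgebra (@tail_coalg k Q C).
Proof. exact: (@TC_subcoalgebra k S0 CC). Qed.

Lemma TCpredE (x : kQ k T) : x \in @TCpred k Q C <-> @tail_coalg k Q C x.
Proof.
have [_ TS _ _] := proj1 (subcoalgebraP _) tail_coalg_subcoalgebra.
split=> [/pbP [s [Hs ->]]|xT]; last first.
  apply/pbP; exists [:: (1, x)]; split; last by rewrite big_seq1 scale1r.
  by move=> t [<-|[]].
elim: s Hs => [|t s IH] H; first by rewrite big_nil; case: TS.
rewrite big_cons; apply: (subspaceL _ TS); first by apply: H; left.
by apply: IH => t' ht; apply: H; right.
Qed.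

Lemma tail_coalg_val x : @tail_coalg k Q C (val x).
Proof. by apply/TCpredE; exact: valP. Qed.

Lemma TCrowE (x : kQ k T) p : TCrow x p = lquo x p.
Proof. exact: slicel_comult. Qed.

Lemma TCval_linear a x y : val (a *: x + y) = a *: val x + val y.
Proof. by rewrite raddfD; congr (_ + _); exact: linearZ. Qed.

(** T(C) is closed under left quotients, so the default 0 is never substituted for one of them. *)
Lemma val_insubd_lquo x p :
  val (insubd (0 : TCcar C) (lquo (val x) p)) = lquo (val x) p.
Proof.
rewrite insubdK //; apply/TCpredE.
have [_ _ H _] := proj1 (subcoalgebraP _) tail_coalg_subcoalgebra.
exact/H/tail_coalg_val.
Qed.

Lemma val_TCcoact x p : val (TCcoact x)@_p = lquo (val x) p.
Proof.
rewrite /TCcoact raddf_sum /=.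
under eq_bigr => q _ do rewrite mcoeffU TCrowE.
set s := undup _; have [ps|ps] := boolP (p \in s).
  rewrite (bigD1_seq p) ?undup_uniq //= eqxx big1 ?addr0 => [|q /negbTE ->] //.
  exact: val_insubd_lquo.
rewrite big_seq big1 => [|q qs].
  apply/malgP => q; rewrite -slicel_comult slicelE mcoeff0 mcoeff_outdom //.
  by apply: contra ps => pq; rewrite mem_undup; apply/mapP; exists (p, q).
by case: eqP => // qp; rewrite -qp qs in ps.
Qed.

Lemma tail_comodule_is_comod : is_comod (@tail_coalg k Q C) (tail_comodule C).
Proof.
have [_ TS _ _] := proj1 (subcoalgebraP _) tail_coalg_subcoalgebra.
have vE x p : val (coaction (tail_comodule C) x)@_p = lquo (val x) p.
  exact: val_TCcoact.
apply/is_comodP; split.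
- move=> a x y p; apply: val_inj.
  rewrite (vE (a *: x + y)) (TCval_linear a x y) lquo_linear -(vE x) -(vE y).
  exact/esym/TCval_linear.
(* A decomposition of the comultiplication with both factors in T(C) is reused, its right factors
   being retyped as elements of the carrier. *)
- move=> x; have [_ [_ H]] := tail_coalg_subcoalgebra.
  have [s [sT E]] := H _ (tail_coalg_val x).
  apply/in_DtensMP; exists [seq (t.1, insubd (0 : TCcar C) t.2) | t <- s]; split.
    by move=> t /List.in_map_iff [t' [<- /sT []]].
  move=> p; apply: val_inj; rewrite vE big_map (lquo_tensor _ E) raddf_sum.
  apply: eq_bigr_In => t ts.
  have t2 : val (insubd (0 : TCcar C) t.2) = t.2.
    by apply: insubdK; apply/TCpredE; case: (sT t ts).
  by rewrite -[in LHS]t2; exact/esym/linearZ.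
- move=> x; apply: val_inj; rewrite raddf_sum (eq_bigr _ (fun p _ => vE x p)).
  apply: sum_trivial_lquo => v nz; rewrite -mcoeff_neq0.
  by apply: contra_neq nz => c0; rewrite -vE c0.
move=> x p q; apply: val_inj.
rewrite (vE _ q) (vE x p) lquo_lquo -(vE x (pcat p q)).
exact/esym/raddfMn.
Qed.
End TailComoduleTheory.

(** * Comodule maps out of the tail closure *)

Section TailHom.
Variables (k : fieldType) (S0 : stage k).
Hypothesis SC0 : subcoalgebra (@sC k S0).
Notation Qn n := (sQ (iter_bar S0 n)).
Notation Cn n := (@sC k (iter_bar S0 n)).
Notation Tn n := (T_mor S0 n).
Let T : quiver := TQ S0.
Variables (N : nat) (F : newV (iter_bar S0 N)).

(* [tip] and [tailq] are e_F and q_F, seen in T(Q). *)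
Definition tip : qV T := mV (Tn N.+1) (inr F : qV (Qn N.+1)).
Definition tailq : kQ k T := push (Tn N.+1) (qF F : kQ k (Qn N.+1)).
Definition agree (z z' : kQ k T) : Prop :=
  forall r : rpath T, ptarget r = tip -> z@_r = z'@_r.

Lemma tailq_TC : @TC k S0 tailq.
Proof. by apply/TCP; exists N.+1, (qF F); split=> //; exact: barC_qF. Qed.

(** Both sides are the coefficient of p q in p_i. If [p] is not old both vanish: a valid path cannot
    return to an old vertex. *)
Lemma lquo_qF (i : 'I_#|` val F|) (p : rpath (Qn N.+1)) (q : rpath (Qn N)) :
  (lquo (qF F : kQ k (Qn N.+1)) p)@_(tailp i q) =
  (push (bar_mor (iter_bar S0 N)) (rquo (Fp i) q))@_p.
Proof.
have SN := iter_bar_subcoalgebra SC0 N.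
rewrite lquoE; case: (pmapP (bar_mor (iter_bar S0 N)) p) => [[p0 ->]|pP].
  rewrite pcat_tailp qF_tailp push_pmap rquoE; congr (_ *+ nat_of_bool _).
  by rewrite /composable ptarget_pmap (inj_eq
    (@mV_inj _ _ (bar_mor (iter_bar S0 N)))).
rewrite push_out //; case pq : (composable p (tailp i q)); last by rewrite mulr0n.
have /in_kQP -> // := @in_kQ_qF _ _ F.
rewrite valid_pcat // negb_and; apply/orP; left; apply/negP => vp.
by have [p0 /pP] := old_path vp (esym (eqP pq)).
Qed.

Lemma lquo_tailq (i : 'I_#|` val F|) (p : rpath T) (q : rpath (Qn N)) :
  (lquo tailq p)@_(pmap (Tn N.+1) (tailp i q)) =
  (push (Tn N) (rquo (Fp i) q))@_p.
Proof.
rewrite -push_T_bar /tailq; case: (pmapP (Tn N.+1) p) => [[p0 ->]|pP].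
  by rewrite lquo_push !push_pmap; exact: lquo_qF.
by rewrite lquo_push_out // mcoeff0 [RHS]push_out.
Qed.

(** For y = p_i / q the functional is the coefficient at q alpha_(i,F). The elements admitting such
    a functional form a subspace, hence contain the whole span. *)
Lemma tail_functional (y : kQ k (Qn N)) : rquospan (mem_fset (val F)) y ->
  exists l : kQ k T -> k,
    [/\ forall a u v, l (a *: u + v) = a * l u + l v,
        forall z z', agree z z' -> l z = l z' &
        forall p, l (lquo tailq p) = (push (Tn N) y)@_p].
Proof.
pose W (y : kQ k (Qn N)) := exists l : kQ k T -> k,
    [/\ forall a u v, l (a *: u + v) = a * l u + l v,
        forall z z', agree z z' -> l z = l z' &
        forall p, l (lquo tailq p) = (push (Tn N) y)@_p].
move=> /(_ W); apply; first split.
- exists (fun=> 0); split=> // [a u v|p]; first by rewrite mulr0 addr0.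
  by rewrite pushE msupp0 big_seq_fset0 mcoeff0.
- move=> a u v [l [lL la lE]] [l' [l'L l'a l'E]].
  exists (fun z => a * l z + l' z); split=> [b z z'|z z' zz'|p].
  + rewrite lL l'L !mulrDr addrACA; congr (_ + _ + _).
    by rewrite !mulrA (mulrC a).
  + by rewrite (la _ _ zz') (l'a _ _ zz').
  + by rewrite push_linear coefL lE l'E.
move=> _ [x [q [xF ->]]].
have ix : (index x (enum_fset (val F)) < #|` val F|)%N by rewrite index_mem.
have <- : Fp (Ordinal ix) = x by rewrite /Fp nth_index.
exists (fun z => z@_(pmap (Tn N.+1) (tailp (Ordinal ix) q))); split.
- by move=> a u v; exact: coefL.
- by move=> z z'; apply; rewrite ptarget_pmap ptarget_tailp.
by move=> p; exact: lquo_tailq.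
Qed.

(** Combines one functional for each tensor factor [t.1] with the vector [t.2]. *)
Lemma tail_map (M : lmodType k) (s : seq (kQ k (Qn N) * M)) :
  (forall t, List.In t s -> rquospan (mem_fset (val F)) t.1) ->
  exists f : kQ k T -> M,
    [/\ forall a u v, f (a *: u + v) = a *: f u + f v,
        forall z z', agree z z' -> f z = f z' &
        forall p, f (lquo tailq p) = \sum_(t <- s) (push (Tn N) t.1)@_p *: t.2].
Proof.
elim: s => [|t s IH] H.
  exists (fun=> 0); split=> // [a u v|p]; first by rewrite scaler0 addr0.
  by rewrite big_nil.
have [l [lL la lE]] := tail_functional (H t (or_introl erefl)).
have [f [fL fa fE]] := IH (fun t' ht' => H t' (or_intror ht')).
exists (fun z => l z *: t.2 + f z); split=> [a u v|z z' zz'|p].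
- by rewrite lL fL scalerDl scalerDr addrACA scalerA.
- by rewrite (la _ _ zz') (fa _ _ zz').
by rewrite big_cons lE fE.
Qed.

Section Equivariance.
Variables (X : precomod k T).
Hypothesis Xcomod : is_comod (@TC k S0) X.
Variables (f : kQ k T -> cM X) (x : cM X).
Hypothesis fL : forall a u v, f (a *: u + v) = a *: f u + f v.
Hypothesis fa : forall z z', agree z z' -> f z = f z'.
Hypothesis fE : forall p, f (lquo tailq p) = (coaction X x)@_p.

(** The comodule map condition at a single [z], so that it can be propagated through the generation
    of T(C). *)
Definition equivariant (z : kQ k T) : Prop :=
  forall p, f (lquo z p) = (coaction X (f z))@_p.

Lemma f_zero : f 0 = 0.
Proof. exact: linear_fun0 fL. Qed.

Lemma f_sum (I : Type) (s : seq I) (P : pred I) (G : I -> kQ k T) :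
  f (\sum_(i <- s | P i) G i) = \sum_(i <- s | P i) f (G i).
Proof.
elim: s => [|i s IH]; first by rewrite !big_nil f_zero.
rewrite !big_cons; case: (P i) => //.
by rewrite -[G i]scale1r fL IH !scale1r.
Qed.

Lemma f_natmul z (b : bool) : f (z *+ b) = f z *+ b.
Proof. by case: b; rewrite ?mulr1n // !mulr0n f_zero. Qed.

(** Write q_F as the sum of its left quotients by trivial paths; [f] turns this into the counit sum
    of [x]. *)
Lemma f_tailq : f tailq = x.
Proof.
(* Large enough for both counit sums, that of q_F and that of [x]. *)
pose d := msupp (coaction X x) `|` [fset trivp p.1 | p in msupp tailq].
rewrite -{1}(@sum_trivial_lquo _ _ tailq d); last first.
  move=> v /eqP nz; rewrite in_fsetU; apply/orP; right.
  have [q qt] : exists q, (lquo tailq (trivp v))@_q != 0.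
    apply: NNPP => h; apply: nz; apply/malgP => q; rewrite mcoeff0.
    by apply: NNPP => /eqP nq; apply: h; exists q.
  apply/imfsetP; exists q; rewrite lquo_triv in qt.
    by rewrite -mcoeff_neq0; apply: contraNneq qt => ->; rewrite mul0rn.
  by case: (eqVneq q.1 v) qt => [<-//|_]; rewrite mulr0n eqxx.
rewrite f_sum (eq_bigr _ (fun p _ => fE p)).
by apply: (counit_widen Xcomod); exact: fsubsetUl.
Qed.

(** Removing a prefix does not change the target of a path. *)
Lemma agree_lquo z z' p : agree z z' -> agree (lquo z p) (lquo z' p).
Proof.
move=> zz' r tr; rewrite !lquoE; case pr : (composable p r) => //.
by congr (_ *+ _); apply: zz'; rewrite ptarget_pcat.
Qed.

Lemma equivariant_agree z z' : agree z z' -> equivariant z' -> equivariant z.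
Proof.
move=> zz' H p; rewrite (fa zz') -H; apply: fa; exact: agree_lquo.
Qed.

Lemma equivariant_subspace : subspace equivariant.
Proof.
have [XL _ _ _] := Xcomod.
split=> [p|a u v Hu Hv p].
  have -> : lquo (0 : kQ k T) p = 0.
    by apply/malgP => q; rewrite lquoE !mcoeff0 mul0rn.
  by rewrite f_zero (coact0 Xcomod) mcoeff0.
by rewrite lquo_linear !fL XL Hu Hv.
Qed.

Lemma equivariant_vanishing z :
  (forall r : rpath T, ptarget r = tip -> z@_r = 0) -> equivariant z.
Proof.
move=> z0; apply: (@equivariant_agree _ 0); last by case: equivariant_subspace.
by move=> r /z0 ->; rewrite mcoeff0.
Qed.

(** Iterated left quotients and iterated coactions follow the same concatenation rule. *)
Lemma equivariant_lquo z p : equivariant z -> equivariant (lquo z p).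
Proof.
have [_ _ _ XA] := proj1 (is_comodP _ _) Xcomod.
by move=> H q; rewrite lquo_lquo f_natmul !H XA.
Qed.

Lemma equivariant_tailq : equivariant tailq.
Proof. by move=> p; rewrite f_tailq. Qed.

Lemma tip_pmap m (p : rpath (Qn m)) :
  ptarget (pmap (Tn m) p) = tip -> (N < m)%N.
Proof. by rewrite ptarget_pmap => /embV_new. Qed.

Lemma tip_target (p : rpath (Qn N.+1)) :
  ptarget (pmap (Tn N.+1) p) = tip -> ptarget p = inr F.
Proof. by rewrite ptarget_pmap => /(@mV_inj _ _ (Tn N.+1) _ _). Qed.

Lemma equivariant_below m (c : kQ k (Qn m)) : (m <= N)%N ->
  equivariant (push (Tn m) c).
Proof.
move=> mN; apply: equivariant_vanishing => r tr.
case: (pmapP (Tn m) r) => [[p rp]|/push_out //].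
by move: tr; rewrite rp => /tip_pmap; rewrite ltnNge mN.
Qed.

(** By minimality, it suffices that the valid equivariant elements form a subcoalgebra containing
    level [N] and every q_F'. The delicate point is closure under right quotients. *)
Lemma equivariant_at (c : kQ k (Qn N.+1)) : Cn N.+1 c ->
  equivariant (push (Tn N.+1) c).
Proof.
have SN := iter_bar_subcoalgebra SC0 N.
have [SN1 _ _ _] := proj1 (subcoalgebraP _) SN.
have [eq0 eqL] := equivariant_subspace.
pose D (z : kQ k (Qn N.+1)) := in_kQ z /\ equivariant (push (Tn N.+1) z).
move=> Cc; suff [] : D c by [].
apply: (iter_bar_min Cc).
- apply/subcoalgebraP; split=> [z []//||z p [zv ze]|z q [zv ze]].
  + split=> [|a u v [uv ue] [vv ve]]; split.
    * by case: (@in_kQ_subspace k (Qn N.+1)).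
    * by rewrite pushE msupp0 big_seq_fset0.
    * exact: (subspaceL _ (@in_kQ_subspace k (Qn N.+1))).
    * by rewrite push_linear; apply: eqL.
  + split; first exact: in_kQ_lquo.
    by rewrite -lquo_push; exact: equivariant_lquo.
  + split; first exact: in_kQ_rquo.
    (* As e_F is a sink at level [N.+1], only the trivial path can follow a path ending there: this
       quotient agrees with [z] at e_F, and all others vanish there. *)
    have [qt|qt] := eqVneq q (trivp (inr F : qV (Qn N.+1))).
      apply: (equivariant_agree _ ze) => r tr.
      case: (pmapP (Tn N.+1) r) => [[p rp]|rP]; last first.
        exact: (etrans (push_out _ rP) (esym (push_out _ rP))).
      have tp : ptarget p = inr F by apply: tip_target; rewrite -rp.
      have pE (y : kQ k (Qn N.+1)) : (push (Tn N.+1) y)@_r = y@_p.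
        by rewrite rp; exact: push_pmap.
      have e : (rquo z q)@_p = z@_p by rewrite qt rquo_triv tp eqxx mulr1n.
      exact: (etrans (pE (rquo z q)) (etrans e (esym (pE z)))).
    apply: equivariant_vanishing => r tr.
    case: (pmapP (Tn N.+1) r) => [[p rp]|/push_out //].
    have tp : ptarget p = inr F by apply: tip_target; rewrite -rp.
    rewrite rp push_pmap rquoE; case pq : (composable p q); last by rewrite mulr0n.
    move/in_kQP: zv => -> //; rewrite valid_pcat // negb_and; apply/orP; right.
    apply: contra_neqN qt => vq; apply: (no_arrow_from_new vq).
    by rewrite (eqP pq).
- move=> z Cz; split; first exact/in_kQ_push/SN1.
  by rewrite push_T_bar; exact: equivariant_below.
move=> F'; split; first exact: in_kQ_qF.
(* For another [F'], all paths of q_F' end at e_F' and so are invisible to [f]. *)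
have [->|FF'] := eqVneq F' F; first exact: equivariant_tailq.
apply: equivariant_vanishing => r tr.
case: (pmapP (Tn N.+1) r) => [[p rp]|/push_out //].
have tp : ptarget p = inr F by apply: tip_target; rewrite -rp.
rewrite rp push_pmap; case: (tailpP F' p) => [[i [q pq]]|/qF_out //].
by move: tp; rewrite pq ptarget_tailp => -[E]; rewrite E eqxx in FF'.
Qed.

(** Induction on the level. Except in the step from [N] to [N.+1], an element agrees at e_F with its
    restriction to the previous level. *)
Lemma equivariant_TC z : @TC k S0 z -> equivariant z.
Proof.
move=> /TCP [m [c [Cc ->]]].
elim: m c Cc => [|m IH] c Cc; first exact: equivariant_below.
have [mN|mN] := eqVneq m N.
  by move: c Cc {IH}; rewrite mN => c Cc; exact: equivariant_at.
have [c' [Cc' cE]] := bar_restricts (iter_bar_subcoalgebra SC0 m) Cc.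
have [cv _ _ _] := proj1 (subcoalgebraP _) (iter_bar_subcoalgebra SC0 m.+1).
apply: equivariant_agree (IH _ Cc') => r tr.
case: (pmapP (Tn m.+1) r) => [[p rp]|rP]; last first.
  have rP' : forall p, r <> pmap (Tn m) p.
    by move=> p rp; exact: rP (etrans rp (esym (@pmap_T_bar _ S0 m p))).
  exact: (etrans (push_out _ rP) (esym (push_out _ rP'))).
case: (pmapP (bar_mor (iter_bar S0 m)) p) => [[p0 pp]|pP].
  by rewrite rp pp push_pmap cE (@pmap_T_bar _ S0 m p0) push_pmap.
rewrite rp push_pmap [RHS]push_out; last first.
  move=> p0; rewrite -(@pmap_T_bar _ S0 m p0) => E.
  have E' := @pmap_inj _ _ (Tn m.+1) _ _ E.
  exact: pP p0 E'.
(* A valid path that is not old ends at a vertex created at this step, which is not e_F because [m]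
   differs from [N]. *)
move/in_kQP: (cv _ Cc) => -> //; apply/negP => vp.
case tp : (ptarget p) => [v|F']; first by have [p0 /pP] := old_path vp tp.
move: tr; rewrite rp ptarget_pmap tp => -[E _].
by rewrite E eqxx in mN.
Qed.
End Equivariance.
End TailHom.

(** * Reaching every element of a comodule *)

Section Generation.
Variables (k : fieldType) (S0 : stage k).
Hypothesis SC0 : subcoalgebra (@sC k S0).
Notation Qn n := (sQ (iter_bar S0 n)).
Notation Cn n := (@sC k (iter_bar S0 n)).
Notation Tn n := (T_mor S0 n).
Let T : quiver := TQ S0.

(** Finitely many elements of an increasing union lie in one member; the pairing with [M] is kept
    during the lift. *)
Lemma TC_common_level (M : Type) (s : seq (kQ k T * M)) :
  (forall t, List.In t s -> @TC k S0 t.1) ->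
  exists n (s' : seq (kQ k (Qn n) * M)), (forall t, List.In t s' -> Cn n t.1) /\
    s = [seq (push (Tn n) t.1, t.2) | t <- s'].
Proof.
move=> sT; have [n nT] : exists n, forall t, List.In t s -> TCn n t.1.
  elim: s sT => [|t s IH] sT; first by exists 0%N.
  have [n nT] := IH (fun t' ht' => sT t' (or_intror ht')).
  have /TCP [m mT] := sT t (or_introl erefl).
  exists (maxn n m) => t' [<-|/nT]; first exact: TCn_mono (leq_maxr n m) mT.
  by apply: TCn_mono; exact: leq_maxl.
exists n; elim: s nT {sT} => [|[c m] s IH] nT; first by exists [::].
have [s' [s'C ->]] := IH (fun t' ht' => nT t' (or_intror ht')).
have [c' [Cc' /= ->]] := nT (c, m) (or_introl erefl).
by exists ((c', m) :: s'); split=> // t [<-|/s'C].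
Qed.

Lemma In_map_fst (I : eqType) (M : Type) (s : seq (I * M)) t :
  List.In t s -> t.1 \in [seq u.1 | u <- s].
Proof.
by elim: s => //= u s IH [->|/IH]; rewrite inE ?eqxx // => ->; rewrite orbT.
Qed.

Lemma mem_In (I : eqType) (s : seq I) t : t \in s -> List.In t s.
Proof. by elim: s => //= u s IH; rewrite inE => /orP [/eqP ->|/IH]; auto. Qed.

Lemma tail_equivariant_map (X : precomod k T) (x : cM X) :
  is_comod (@TC k S0) X ->
  exists f : kQ k T -> cM X,
    [/\ forall a u v, f (a *: u + v) = a *: f u + f v,
        forall z, @TC k S0 z -> forall p, f (lquo z p) = (coaction X (f z))@_p &
        exists2 z, @TC k S0 z & f z = x].
Proof.
move=> Xc; have [_ XD _ _] := Xc.
have [s [sT sE]] := proj1 (in_DtensMP _ _) (XD x).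
have [N [s' [s'C ss']]] := TC_common_level sT.
have [|F [Find Fspan]] :=
  exists_independent (cs := [seq t.1 | t <- s']) (iter_bar_subcoalgebra SC0 N).
  move=> c /mapP [t ts ->]; apply: s'C.
  exact: mem_In.
pose F' : newV (iter_bar S0 N) := exist _ F (introT (pbP _) Find).
have [|f [fL fa fE]] := @tail_map k S0 SC0 N F' (cM X) s'.
  by move=> t ts; apply: Fspan; exact: In_map_fst.
have {}fE p : f (lquo (tailq F') p) = (coaction X x)@_p.
  by rewrite fE sE ss' big_map.
exists f; split=> //; first exact: (equivariant_TC SC0 Xc fL fa fE).
exists (tailq F'); first exact: tailq_TC.
exact: (f_tailq Xc fL fE).
Qed.
End Generation.

(* For an admissible subcoalgebra C of kQ, the tail closure T(C) is a
   generator of the category of left T(C)-comodules. *)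
Theorem theorem4p27 (k : fieldType) (Q : quiver) (C : kQ k Q -> Prop) :
  admissible C ->
  is_generator (@tail_coalg k Q C) (tail_comodule C).
Proof.
move=> [CC _] X Xc.
have Gc := tail_comodule_is_comod CC.
have H x : exists f : TCcar C -> cM X,
    is_hom (X := tail_comodule C) f /\ exists g, f g = x.
  have [f [fL fE [z zT fz]]] := @tail_equivariant_map k (Stage C) CC X x Xc.
  exists (f \o val); split; last first.
    exists (insubd (0 : TCcar C) z); rewrite [LHS](f_equal f (insubdK _ _)) //.
    exact/TCpredE.
  split=> [a u v|g p]; first by rewrite -fL; congr f; exact: TCval_linear.
  rewrite [LHS](esym (fE _ _ _)); last exact: tail_coalg_val.
  by congr f; apply/esym/val_TCcoact.
(* One comodule map through each [x] is chosen; the copower is then indexed by the elements of [X]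
   themselves. *)
pose f x := sval (constructive_indefinite_description _ (H x)).
have fP x : is_hom (X := tail_comodule C) (f x) /\ exists g, f x g = x.
  exact: svalP (constructive_indefinite_description _ (H x)).
have PC := @copower_coproduct _ _ _ _ (cM X) Gc.
have [_ _ univ] := PC.
have [e [eh eu _]] := univ X f Xc (fun x => proj1 (fP x)).
exists (cM X), (copower_comod (tail_comodule C) (cM X)), (@copower_in _ _ _ _), e.
split=> //; apply: surjective_epi => x.
by have [_ [g gx]] := fP x; exists (copower_in (G := tail_comodule C) x g);
   rewrite eu.
Qed.
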